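(* There is an equivalence of categories between ${\sf{BrwMS}_P}$ and ${\sf{BrwFrm}}$, a dual equivalence between ${\sf{BrwFrm}}$ and ${\sf{PGES}_P}$, and the triangle formed by these (with functors $\mathcal{F}:{\sf{BrwMS}_P}\to{\sf{BrwFrm}}$, $\mathcal{K}:{\sf{BrwFrm}}\to{\sf{BrwMS}_P}$, $\mathcal{X}:{\sf{BrwMS}_P}\to{\sf{PGES}_P}$, $\mathcal{A}:{\sf{PGES}_P}\to{\sf{BrwMS}_P}$, $\mathcal{Y}:{\sf{BrwFrm}}\to{\sf{PGES}_P}$, $\mathcal{V}^a:{\sf{PGES}_P}\to{\sf{BrwFrm}}$) commutes up to natural isomorphism.
   Context: A Brouwerian semilattice is a meet-semilattice $A$ (all finite meets exist, so $A$ has a top but possibly no bottom) with an implication $\to$ satisfying $x\le a\to b$ iff $a\wedge x\le b$. A prime filter of a meet-semilattice $A$ is a meet-prime element of the frame $\mathcal{F}(A)$ of filters of $A$. ${\sf{BrwMS}_P}$ is the category of Brouwerian semilattices and maps $h$ that preserve finite meets (including top) and implication, preserve all existing finite joins, and satisfy that $h^{-1}(P)$ is a prime filter for every prime filter $P$ of the codomain. For a frame $L$, $K(L)$ is the set of compact elements; $L$ is algebraic if every element is a join of compact elements. A Brouwerian frame is an algebraic frame $L$ such that the order-dual $K(L)^d$ is a Brouwerian semilattice. ${\sf{BrwFrm}}$ is the category of Brouwerian frames and frame homomorphisms $\alpha:L\to M$ sending compact elements to compact elements and satisfying $\alpha(a\to b)=\alpha(a)\to\alpha(b)$ for $a,b\in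 K(L)$, the implications computed in $K(L)^d$ and $K(M)^d$. A pointed Priestley space is a Priestley space $X$ with unique maximum $m$. Given $X_0\subseteq X\setminus\{m\}$, a subset $U$ is admissible if $X\setminus U\subseteq{\downarrow}(X_0\setminus U)$; $\mathcal{A}(X)$ denotes the admissible clopen upsets and $\mathcal{I}_x=\{U\in\mathcal{A}(X):x\notin U\}$. A pointed generalized Priestley space is a triple $(X,X_0,m)$ with $(X,m)$ pointed Priestley, $X_0$ a cofinal dense subset of $X\setminus\{m\}$, $x\in X_0$ iff $\mathcal{I}_x$ is nonempty and directed, and $x\le y$ iff every $U\in\mathcal{A}(X)$ containing $x$ contains $y$. It is a pointed generalized Esakia space if ${\downarrow}(U\setminus V)$ is clopen for all $U,V\in\mathcal{A}(X)$. ${\sf{PGES}_P}$ is the category of pointed generalized Esakia spaces and order-preserving maps $f:X\to Y$ such that $f^{-1}(U)\in\mathcal{A}(X)$ for $U\in\mathcal{A}(Y)$, $f[X_0]\subseteq Y_0$, and whenever $x\in X$, $y\in Y_0$, $f(x)\le y$, there is $z\in X_0$ with $x\le z$ and $f(z)=y$. Functors: $\mathcal{F}(A)$ is the frame of filters of $A$ ordered by inclusion and $\mathcal{F}(h)(F)={\uparrow}h[F]$; $\mathcal{K}(L)=K(L)^d$ and $\mathcal{K}(\alpha)$ is the restriction of $\alpha$; $\mathcal{A}(X)$ is the admissible clopen upsets and $\mathcal{A}(f)=f^{-1}$; $\mathcal{X}(A)=(X_A,\mathrm{Pr}(A),A)$ where $X_A$ is the set of optimal filters of $A$ together with $A$,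 ordered by inclusion, with topology generated by the sets $\varphi(a)=\{x\in X_A: a\in x\}$ and their complements, and $\mathrm{Pr}(A)$ the prime filters; $\mathcal{V}^a(X)$ is the set of admissible closed upsets of $X$ ordered by reverse inclusion and $\mathcal{V}^a(f)=f^{-1}$; $\mathcal{Y}(L)=(Y_L,P(L),1)$ where $Y_L$ is the set of pseudoprime elements of $L$ together with $1$ (ordered as in $L$, topology generated by ${\uparrow}k\cap Y_L$ and $({\uparrow}l)^c\cap Y_L$ for $k,l\in K(L)$) and $P(L)$ the prime elements, and $\mathcal{Y}(\alpha)$ is the right adjoint of $\alpha$. These functors are restrictions of those giving the equivalence between distributive meet-semilattices (with such morphisms) and algebraic frames and the corresponding dual equivalence with pointed generalized Priestley spaces. *)

(* Defs.v *)
From HB Require Import structures.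
From mathcomp Require Import all_boot all_order all_classical topology.

Set Implicit Arguments.
Unset Strict Implicit.
Unset Printing Implicit Defensive.

Import Order.TTheory.
Local Open Scope classical_set_scope.
Local Open Scope order_scope.

Record category := Category {
  obj :> Type;
  hom : obj -> obj -> Type;
  idc : forall x, hom x x;
  comp : forall x y z, hom y z -> hom x y -> hom x z;
  comp1c : forall x y (f : hom x y), comp (idc y) f = f;
  compc1 : forall x y (f : hom x y), comp f (idc x) = f;
  compcA : forall x y z t (f : hom z t) (g : hom y z) (h : hom x y),
    comp f (comp g h) = comp (comp f g) h }.

Arguments hom {c} x y : rename.
Arguments idc {c} x : rename.
Arguments comp {c} [x y z] f g : rename.

Definition op_cat (C : category) : category :=
  @Category C (fun a b => hom b a) (@idc C) (fun _ _ _ f g => comp g f)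
    (fun _ _ f => compc1 f) (fun _ _ f => comp1c f)
    (fun _ _ _ _ f g h => esym (compcA h g f)).

(* Functors are indexed by their action on objects; a contravariant functor
   from C to D is a functor from [op_cat C] to D, or from C to [op_cat D]. *)
Record functor (C D : category) (F0 : C -> D) := Functor {
  fmap : forall a b : C, hom a b -> hom (F0 a) (F0 b);
  fmap1 : forall a, fmap (idc a) = idc (F0 a);
  fmapM : forall a b c (f : hom b c) (g : hom a b),
    fmap (comp f g) = comp (fmap f) (fmap g) }.

Arguments functor : clear implicits.
Arguments fmap {C D F0} _ {a b}.

Definition id_functor (C : category) : functor C C id :=
  @Functor C C id (fun _ _ f => f) (fun _ => erefl) (fun _ _ _ _ _ => erefl).

Section functor_operations.
Context {B C D : category}.

Lemma comp_fmap1 {F0 : B -> C} {G0 : C -> D}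
    (G : functor C D G0) (F : functor B C F0) a :
  fmap G (fmap F (idc a)) = idc (G0 (F0 a)).
Proof. by rewrite !fmap1. Qed.

Lemma comp_fmapM {F0 : B -> C} {G0 : C -> D}
    (G : functor C D G0) (F : functor B C F0) a b c
    (f : hom b c) (g : hom a b) :
  fmap G (fmap F (comp f g)) = comp (fmap G (fmap F f)) (fmap G (fmap F g)).
Proof. by rewrite !fmapM. Qed.

Definition comp_functor {F0 : B -> C} {G0 : C -> D}
    (G : functor C D G0) (F : functor B C F0) :
    functor B D (fun a => G0 (F0 a)) :=
  @Functor B D (fun a => G0 (F0 a)) (fun _ _ f => fmap G (fmap F f))
    (comp_fmap1 G F) (comp_fmapM G F).

Definition op_functor {F0 : C -> D} (F : functor C D F0) :
    functor (op_cat C) (op_cat D) F0 :=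
  @Functor (op_cat C) (op_cat D) F0 (fun a b (f : @hom C b a) => fmap F f)
    (fmap1 F) (fun _ _ _ f g => fmapM F g f).

Definition isomorphism {a b : C} (f : hom a b) : Prop :=
  exists g : hom b a, comp g f = idc a /\ comp f g = idc b.

End functor_operations.

Definition nat_iso {C D : category} {F0 G0 : C -> D}
    (F : functor C D F0) (G : functor C D G0) : Prop :=
  exists eta : forall a, hom (F0 a) (G0 a),
    (forall a b (f : hom a b),
       comp (fmap G f) (eta a) = comp (eta b) (fmap F f)) /\
    (forall a, isomorphism (eta a)).

Definition equivalence_of_categories {C D : category} {F0 : C -> D}
    {G0 : D -> C} (F : functor C D F0) (G : functor D C G0) : Prop :=
  nat_iso (comp_functor G F) (id_functor C) /\
  nat_iso (comp_functor F G) (id_functor D).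

Notation "G '\oF' F" := (comp_functor G F) (at level 50, left associativity).

Lemma sval_inj {T : Type} {P : T -> Prop} : injective (@sval T P).
Proof. by move=> x y; apply: eq_sig_hprop => z; apply: Prop_irrelevance. Qed.

HB.instance Definition _ (T : choiceType) (A : set T) :=
  SubChoice.on (set_type A).
HB.instance Definition _ d (T : porderType d) (A : set T) :=
  [SubChoice_isSubPOrder of set_type A by <: with d].

(* [infimums [set a; b] m] reads: m is the meet of a and b (and dually). *)
Section order_notions.
Context {d : Order.disp_t} {T : porderType d}.
Implicit Types (a b c m p k x y : T) (S U F I : set T).

Definition upclosure S : set T := [set y | exists2 x, S x & x <= y].

Definition downclosure S : set T := [set x | exists2 y, S y & x <= y].

Definition upset U : Prop := forall x y, U x -> x <= y -> U y.

Definition downset U : Prop := forall x y, U y -> x <= y -> U x.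

Definition directed S : Prop :=
  forall x y, S x -> S y -> exists z, [/\ S z, x <= z & y <= z].

(* c is a -> b, i.e. x <= c iff the meet of a and x is <= b. *)
Definition is_implication a b c : Prop :=
  forall x m, infimums [set a; x] m -> (x <= c) = (m <= b).

(* In a meet-semilattice, the case of the empty S says that the top is in F. *)
Definition is_filter F : Prop :=
  upset F /\
  forall S m, finite_set S -> S `<=` F -> infimums S m -> F m.

Definition is_ideal I : Prop :=
  downset I /\
  forall S j, finite_set S -> S `<=` I -> supremums S j -> I j.

Definition prime_ideal I : Prop :=
  [/\ is_ideal I, I <> setT &
      forall a b m, infimums [set a; b] m -> I m -> I a \/ I b].

Definition meet_prime p : Prop :=
  ~ (forall x, x <= p) /\
  forall a b m, infimums [set a; b] m -> m <= p -> a <= p \/ b <= p.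

Definition pseudoprime p : Prop := exists2 I, prime_ideal I & supremums I p.

Definition frink_ideal I : Prop :=
  forall S, finite_set S -> S `<=` I -> lbound (ubound S) `<=` I.

(* Complements of filters are prime in the sense that they contain a or b when
   they contain the meet of a and b, so optimal filters are the complements of
   prime Frink ideals. Whether the full filter is optimal does not matter
   below, and likewise for the top as a pseudoprime element. *)
Definition optimal_filter F : Prop := is_filter F /\ frink_ideal (~` F).

Definition compact_element k : Prop :=
  forall S s, supremums S s -> k <= s ->
    exists S' t, [/\ finite_set S', S' `<=` S, supremums S' t & k <= t].

End order_notions.

Definition is_brouwerian d (A : porderType d) : Prop :=
  (forall S : set A, finite_set S -> infimums S !=set0) /\
  (forall a b : A, exists c, is_implication a b c).

Definition is_frame d (L : porderType d) : Prop :=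
  (forall S : set L, supremums S !=set0) /\
  (forall (a : L) S s m, supremums S s -> infimums [set a; s] m ->
     supremums [set x | exists2 b, S b & infimums [set a; b] x] m).

Definition compacts d (L : porderType d) : set L :=
  [set k : L | compact_element k].

Definition is_algebraic d (L : porderType d) : Prop :=
  forall x : L, exists2 S, S `<=` @compacts d L & supremums S x.

Definition compacts_dual d (L : porderType d) : porderType (Order.dual_display d) :=
  ((@compacts d L : Type)^d)%O.

Definition is_brouwerian_frame d (L : porderType d) : Prop :=
  [/\ is_frame L, is_algebraic L & is_brouwerian (compacts_dual L)].

Definition filters d (A : porderType d) : set (set A) :=
  [set F : set A | is_filter F].

(* The filters that are meet-prime elements of the poset of all filters. *)
Definition prime_filter d (A : porderType d) (P : set A) : Prop :=
  exists2 Q : @filters d A, val Q = P & meet_prime Q.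

Section preservation.
Context {d d' : Order.disp_t} {A : porderType d} {B : porderType d'}.
Variable h : A -> B.

Definition preserves_finite_meets : Prop :=
  forall S m, finite_set S -> infimums S m -> infimums (h @` S) (h m).

Definition preserves_finite_joins : Prop :=
  forall S j, finite_set S -> supremums S j -> supremums (h @` S) (h j).

Definition preserves_joins : Prop :=
  forall S j, supremums S j -> supremums (h @` S) (h j).

Definition preserves_implication : Prop :=
  forall a b c, is_implication a b c -> is_implication (h a) (h b) (h c).

End preservation.

Section preservation_lemmas.
Context {d1 d2 d3 : Order.disp_t}.
Context {A : porderType d1} {B : porderType d2} {C : porderType d3}.
Variables (g : B -> C) (f : A -> B).

Lemma preserves_finite_meets_id : preserves_finite_meets (@id A).
Proof. by move=> S m _; rewrite image_id. Qed.

Lemma preserves_finite_meets_comp : preserves_finite_meets g ->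
  preserves_finite_meets f -> preserves_finite_meets (g \o f).
Proof.
move=> gm fm S m Sfin /(fm _ _ Sfin) /(gm _ _ (finite_image _ Sfin)).
by rewrite image_comp.
Qed.

Lemma preserves_finite_joins_id : preserves_finite_joins (@id A).
Proof. by move=> S m _; rewrite image_id. Qed.

Lemma preserves_finite_joins_comp : preserves_finite_joins g ->
  preserves_finite_joins f -> preserves_finite_joins (g \o f).
Proof.
move=> gm fm S m Sfin /(fm _ _ Sfin) /(gm _ _ (finite_image _ Sfin)).
by rewrite image_comp.
Qed.

Lemma preserves_joins_id : preserves_joins (@id A).
Proof. by move=> S m; rewrite image_id. Qed.

Lemma preserves_joins_comp : preserves_joins g ->
  preserves_joins f -> preserves_joins (g \o f).
Proof. by move=> gm fm S m /fm /gm; rewrite image_comp. Qed.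

End preservation_lemmas.

Record brwMS := BrwMSObj {
  brwMS_disp : Order.disp_t;
  brwMS_sort :> porderType brwMS_disp;
  brwMSP : is_brouwerian brwMS_sort }.

Definition is_brwMS_hom (A B : brwMS) (h : A -> B) : Prop :=
  [/\ preserves_finite_meets h, preserves_implication h,
      preserves_finite_joins h &
      forall P : set B, prime_filter P -> prime_filter (h @^-1` P)].

Definition brwMS_hom (A B : brwMS) : Type := {h : A -> B | is_brwMS_hom h}.

Lemma is_brwMS_hom_id (A : brwMS) : is_brwMS_hom (@id A).
Proof.
split=> //; first exact: preserves_finite_meets_id.
exact: preserves_finite_joins_id.
Qed.

Lemma is_brwMS_hom_comp (A B C : brwMS) (g : brwMS_hom B C)
  (f : brwMS_hom A B) : is_brwMS_hom (sval g \o sval f).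
Proof.
case: g f => [g [gm gi gj gp]] [f [fm fi fj fp]] /=; split.
- exact: preserves_finite_meets_comp.
- by move=> a b c /fi /gi.
- exact: preserves_finite_joins_comp.
- by move=> P /gp /fp.
Qed.

Definition BrwMS_P : category.
Proof.
refine (@Category brwMS brwMS_hom (fun A => exist _ _ (is_brwMS_hom_id A))
  (fun A B C g f => exist _ _ (is_brwMS_hom_comp g f)) _ _ _).
all: by move=> *; apply: sval_inj.
Defined.

Record brwFrm := BrwFrmObj {
  brwFrm_disp : Order.disp_t;
  brwFrm_sort :> porderType brwFrm_disp;
  brwFrmP : is_brouwerian_frame brwFrm_sort }.

Definition is_frame_hom d d' (L : porderType d) (M : porderType d')
    (alpha : L -> M) : Prop :=
  preserves_joins alpha /\ preserves_finite_meets alpha.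

(* alpha maps compact elements to compact elements, its restriction being k *)
Definition restricts_to_compacts d d' (L : porderType d) (M : porderType d')
    (alpha : L -> M) (k : compacts_dual L -> compacts_dual M) : Prop :=
  forall a : @compacts d L, val (k a : @compacts d' M) = alpha (val a).

Definition is_brwFrm_hom (L M : brwFrm) (alpha : L -> M) : Prop :=
  is_frame_hom alpha /\
  exists2 k : compacts_dual L -> compacts_dual M,
    restricts_to_compacts alpha k & preserves_implication k.

Definition brwFrm_hom (L M : brwFrm) : Type :=
  {alpha : L -> M | is_brwFrm_hom alpha}.

Lemma is_brwFrm_hom_id (L : brwFrm) : is_brwFrm_hom (@id L).
Proof.
split; last by exists id.
by split; [exact: preserves_joins_id|exact: preserves_finite_meets_id].
Qed.

Lemma is_brwFrm_hom_comp (L M N : brwFrm) (g : brwFrm_hom M N)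
  (f : brwFrm_hom L M) : is_brwFrm_hom (sval g \o sval f).
Proof.
case: g f => [g [[gj gm] [k gk gi]]] [f [[fj fm] [l fl fi]]] /=; split.
  by split; [exact: preserves_joins_comp|exact: preserves_finite_meets_comp].
exists (k \o l); last by move=> a b c /fi /gi.
by move=> a /=; rewrite gk fl.
Qed.

Definition BrwFrm : category.
Proof.
refine (@Category brwFrm brwFrm_hom (fun A => exist _ _ (is_brwFrm_hom_id A))
  (fun A B C g f => exist _ _ (is_brwFrm_hom_comp g f)) _ _ _).
all: by move=> *; apply: sval_inj.
Defined.

Section spaces.
Context {d : Order.disp_t} {X : POrderedTopological.type d}.
Variables (X0 : set X) (m : X).

Definition is_priestley : Prop :=
  compact [set: X] /\
  forall x y : X, ~~ (x <= y) ->
    exists U : set X, [/\ clopen U, upset U, U x & ~ U y].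

Definition is_pointed_priestley : Prop :=
  is_priestley /\ forall x : X, x <= m.

Definition admissible (U : set X) : Prop :=
  ~` U `<=` downclosure (X0 `\` U).

Definition adm_clopen_upsets : set (set X) :=
  [set U | [/\ admissible U, clopen U & upset U]].

Definition adm_closed_upsets : set (set X) :=
  [set U | [/\ admissible U, closed U & upset U]].

Definition adm_avoiding (x : X) : set (set X) :=
  [set U | adm_clopen_upsets U /\ ~ U x].

Definition is_pgps : Prop :=
  [/\ is_pointed_priestley,
      [/\ X0 `<=` [set~ m], [set~ m] `<=` closure X0 &
          forall x, x <> m -> exists2 y, X0 y & x <= y],
      forall x, X0 x <-> (adm_avoiding x !=set0 /\ directed (adm_avoiding x)) &
      forall x y, x <= y <-> (forall U, adm_clopen_upsets U -> U x -> U y)].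

Definition is_pges : Prop :=
  is_pgps /\
  forall U V, adm_clopen_upsets U -> adm_clopen_upsets V ->
    clopen (downclosure (U `\` V)).

End spaces.

Record pges := PgesObj {
  pges_disp : Order.disp_t;
  pges_sort :> POrderedTopological.type pges_disp;
  pges_core : set pges_sort;
  pges_max : pges_sort;
  pgesP : is_pges pges_core pges_max }.

Arguments pges_core : clear implicits.
Arguments pges_max : clear implicits.

Definition is_pges_hom (X Y : pges) (f : X -> Y) : Prop :=
  [/\ {homo f : x y / x <= y},
      forall U, adm_clopen_upsets (pges_core Y) U ->
        adm_clopen_upsets (pges_core X) (f @^-1` U),
      f @` pges_core X `<=` pges_core Y &
      forall x y, pges_core Y y -> f x <= y ->
        exists z, [/\ pges_core X z, x <= z & f z = y]].

Definition pges_hom (X Y : pges) : Type := {f : X -> Y | is_pges_hom f}.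

Lemma is_pges_hom_id (X : pges) : is_pges_hom (@id X).
Proof.
split=> //; first by rewrite image_id.
by move=> x y Xy xy; exists y.
Qed.

Lemma is_pges_hom_comp (X Y Z : pges) (g : pges_hom Y Z)
  (f : pges_hom X Y) : is_pges_hom (sval g \o sval f).
Proof.
case: g f => [g [gh gU g0 gl]] [f [fh fU f0 fl]] /=; split.
- by move=> x y /fh /gh.
- by move=> U /gU /fU.
- by move=> _ [x X0x <-]; apply: g0; exists (f x) => //; apply: f0; exists x.
- move=> x z Zz /(gl _ _ Zz) [y [Yy xy <-]].
  by have [w [Xw xw <-]] := fl _ _ Yy xy; exists w.
Qed.

Definition PGES_P : category.
Proof.
refine (@Category pges pges_hom (fun A => exist _ _ (is_pges_hom_id A))
  (fun A B C g f => exist _ _ (is_pges_hom_comp g f)) _ _ _).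
all: by move=> *; apply: sval_inj.
Defined.

Section optimal_space.
Context {d : Order.disp_t} (A : porderType d).

Definition optimal_or_full : set (set A) :=
  [set F | optimal_filter F \/ F = setT].

Definition optimal_space : Type := optimal_or_full.
HB.instance Definition _ := Order.POrder.on optimal_space.

Definition phi (a : A) : set optimal_space := [set x | val x a].

HB.instance Definition _ := isSubBaseTopological.Build optimal_space
  [set U : set optimal_space | exists a, U = phi a \/ U = ~` phi a] id.

Definition prime_points : set optimal_space := [set x | prime_filter (val x)].

Definition full_filter : optimal_space :=
  exist _ setT (mem_set (or_intror erefl)).

End optimal_space.

Section pseudoprime_space.
Context {d : Order.disp_t} (L : porderType d).

Definition pseudoprime_or_top : set L :=
  [set p | pseudoprime p \/ forall x, x <= p].

Definition pseudoprime_space : Type := pseudoprime_or_top.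
HB.instance Definition _ := Order.POrder.on pseudoprime_space.

Definition principal_up (k : L) : set pseudoprime_space := [set y | k <= val y].

HB.instance Definition _ := isSubBaseTopological.Build pseudoprime_space
  [set U : set pseudoprime_space | exists2 k, compact_element k &
     U = principal_up k \/ U = ~` principal_up k] id.

Definition prime_elements : set pseudoprime_space :=
  [set y | meet_prime (val y)].

Lemma frame_top : is_frame L ->
  exists y : pseudoprime_space, forall x : L, x <= val y.
Proof.
move=> [/(_ setT) [t [tub _]] _]; have tP x : x <= t by exact: tub.
by exists (exist _ t (mem_set (or_intror tP))).
Qed.

End pseudoprime_space.

Lemma brwFrm_is_frame (L : brwFrm) : is_frame L.
Proof. by case: (brwFrmP L). Qed.

Lemma brwFrm_compacts_dual (L : brwFrm) : is_brouwerian (compacts_dual L).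
Proof. by case: (brwFrmP L). Qed.

Definition top_element (L : brwFrm) : pseudoprime_space L :=
  sval (cid (frame_top (brwFrm_is_frame L))).

(* The object parts of the functors whose values have to be shown to be objects
   of the target category take a proof of that as an argument. *)
Definition F_wf : Prop := forall A : brwMS, is_brouwerian_frame (@filters _ A).
Definition X_wf : Prop :=
  forall A : brwMS, is_pges (@prime_points _ A) (@full_filter _ A).
Definition A_wf : Prop :=
  forall X : pges, is_brouwerian (adm_clopen_upsets (pges_core X)).
Definition Y_wf : Prop :=
  forall L : brwFrm, is_pges (@prime_elements _ L) (top_element L).
Definition V_wf : Prop :=
  forall X : pges,
    is_brouwerian_frame ((adm_closed_upsets (pges_core X) : Type)^d)%O.

Definition F_obj (w : F_wf) (A : BrwMS_P) : BrwFrm := BrwFrmObj (w A).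

Definition K_obj (L : BrwFrm) : BrwMS_P :=
  BrwMSObj (brwFrm_compacts_dual L).

Definition X_obj (w : X_wf) (A : BrwMS_P) : PGES_P := PgesObj (w A).

Definition A_obj (w : A_wf) (X : PGES_P) : BrwMS_P := BrwMSObj (w X).

Definition Y_obj (w : Y_wf) (L : BrwFrm) : PGES_P := PgesObj (w L).

Definition V_obj (w : V_wf) (X : PGES_P) : BrwFrm := BrwFrmObj (w X).

Definition F_spec (w : F_wf) (F : functor BrwMS_P BrwFrm (F_obj w)) : Prop :=
  forall (A B : brwMS) (h : brwMS_hom A B) (x : @filters _ A),
    val (sval (fmap F h) x : @filters _ B) = upclosure (sval h @` val x).

Definition K_spec (K : functor BrwFrm BrwMS_P K_obj) : Prop :=
  forall (L M : brwFrm) (alpha : brwFrm_hom L M),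
    restricts_to_compacts (sval alpha) (sval (fmap K alpha)).

Definition X_spec (w : X_wf) (X : functor (op_cat BrwMS_P) PGES_P (X_obj w)) :
    Prop :=
  forall (A B : brwMS) (h : brwMS_hom A B) (x : optimal_space B),
    val (sval (@fmap _ _ _ X B A h) x : optimal_space A) =
    sval h @^-1` val x.

Definition A_spec (w : A_wf) (A : functor PGES_P (op_cat BrwMS_P) (A_obj w)) :
    Prop :=
  forall (X Y : pges) (f : pges_hom X Y)
    (U : adm_clopen_upsets (pges_core Y)),
    val (sval (fmap A f) U : adm_clopen_upsets (pges_core X)) =
    sval f @^-1` val U.

(* The right adjoint r of alpha is determined by: alpha a <= y iff a <= r y. *)
Definition Y_spec (w : Y_wf) (Y : functor (op_cat BrwFrm) PGES_P (Y_obj w)) :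
    Prop :=
  forall (L M : brwFrm) (alpha : brwFrm_hom L M)
    (y : pseudoprime_space M) (a : L),
    (sval alpha a <= val y) =
    (a <= val (sval (@fmap _ _ _ Y M L alpha) y : pseudoprime_space L)).

Definition V_spec (w : V_wf) (V : functor PGES_P (op_cat BrwFrm) (V_obj w)) :
    Prop :=
  forall (X Y : pges) (f : pges_hom X Y)
    (U : adm_closed_upsets (pges_core Y)),
    val (sval (fmap V f) U : adm_closed_upsets (pges_core X)) =
    sval f @^-1` val U.

(* Main.v *)
Require Import Defs.
From mathcomp Require Import all_boot all_order finmap all_classical topology.
Import Defs.

(* The functors F, K, X and A are constructed directly, while Y and V are X o K
   and F o A transported along isomorphisms; all the natural isomorphisms then
   follow from KF = 1, FK = 1, AX = 1 and XA = 1.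

   Everything rests on one separation theorem: in a Brouwerian semilattice a
   filter disjoint from a nonempty directed set extends to a prime filter
   disjoint from that set. A filter is prime when its complement is directed and
   nonempty. Separation turns the condition on inverse images of prime filters
   into preservation of finite meets of filters and of the Frink closure of
   finite sets; applied to the directed set of all h a with a outside a prime
   filter Q, it lifts Q along h, which is the condition on PGES_P-morphisms.
   Applied in a frame L itself, it produces the prime ideal showing that an
   element whose set of compact lower bounds is optimal is pseudoprime.

   Brouwerian frames are the posets isomorphic to the filters of a Brouwerian
   semilattice, via x |-> {k compact | k <= x};
     pointed generalized Esakia spaces
   are the spaces of optimal filters, via x |-> {U admissible | x in U}, where
   density of the core and directedness of I_x give optimality and compactness
   gives surjectivity. *)

Set Implicit Arguments.
Unset Strict Implicit.
Unset Printing Implicit Defensive.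

Import Order.TTheory.
Local Open Scope order_scope.
Local Open Scope classical_set_scope.

(** * Natural isomorphisms *)

(** The obstacle is that a Brouwerian semilattice need not have joins, so neither primeness of a
    filter nor the merging of a finite cover can be phrased with them. Upper bounds outside a given
    filter do this work instead, and implication supplies them: [((a -> c) /\ (b -> c)) -> c] is
    always above [a] and [b] and stands in for their join. Directedness of the complement is thus
    the usable form of meet-primeness; it reappears as the axiom on the core of a space, so that
    several compactness arguments end by merging finitely many sets at a core point.

    Finite joins that do exist are not unions on the side of spaces, but they agree with unions on
    core points, which suffices because admissible sets are tested there. *)

Lemma nat_iso_sym (C D : category) (F0 G0 : C -> D)
    (F : functor C D F0) (G : functor C D G0) : nat_iso F G -> nat_iso G F.
Proof.
move=> [eta [etaN etaI]].
pose eps a := sval (cid (etaI a)).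
have epsK a : comp (eps a) (eta a) = idc _ /\ comp (eta a) (eps a) = idc _.
  by rewrite /eps; case: (cid _).
exists eps; split=> [a b f|a]; last first.
  by exists (eta a); case: (epsK a).
have [ka ka'] := epsK a; have [kb kb'] := epsK b.
by rewrite -[RHS]compc1 -ka' !compcA -[in RHS](compcA (eps b)) etaN !compcA kb
  comp1c.
Qed.

Lemma nat_iso_trans (C D : category) (F0 G0 H0 : C -> D)
    (F : functor C D F0) (G : functor C D G0) (H : functor C D H0) :
  nat_iso F G -> nat_iso G H -> nat_iso F H.
Proof.
move=> [s [sN sI]] [t [tN tI]].
exists (fun a => comp (t a) (s a)); split=> [a b f|a].
  by rewrite compcA tN -compcA sN compcA.
have [u [us su]] := sI a; have [v [vt tv]] := tI a.
exists (comp u v); split.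
  by rewrite compcA -(compcA u) vt compc1.
by rewrite compcA -(compcA (t a)) su compc1.
Qed.

Lemma nat_iso_whiskerl (B C D : category) (F0 F1 : B -> C) (G0 : C -> D)
    (G : functor C D G0) (F : functor B C F0) (F' : functor B C F1) :
  nat_iso F F' -> nat_iso (G \oF F) (G \oF F').
Proof.
move=> [s [sN sI]]; exists (fun a => fmap G (s a)); split=> [a b f|a] /=.
  by rewrite -!fmapM sN.
have [u [us su]] := sI a.
by exists (fmap G u); rewrite -!fmapM us su !fmap1.
Qed.

Lemma nat_iso_whiskerr (B C D : category) (F0 : B -> C) (G0 G1 : C -> D)
    (F : functor B C F0) (G : functor C D G0) (G' : functor C D G1) :
  nat_iso G G' -> nat_iso (G \oF F) (G' \oF F).
Proof.
by move=> [s [sN sI]]; exists (fun a => s (F0 a)); split=> [a b f|a] /=.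
Qed.

Lemma nat_iso_op (C D : category) (F0 G0 : C -> D)
    (F : functor C D F0) (G : functor C D G0) :
  nat_iso F G -> nat_iso (op_functor F) (op_functor G).
Proof.
move=> /nat_iso_sym [s [sN sI]]; exists s; split=> [a b f|a] /=.
  by rewrite sN.
by have [u [us su]] := sI a; exists u.
Qed.

(** Functors are typed by their action on objects, so a composite such as [X \oF op_functor K]
    cannot itself have object map [Y_obj]. Conjugation by the isomorphisms moves it to the
    prescribed objects, and the explicit formula allows the specification to be checked. *)
Lemma nat_iso_transport (C D : category) (F0 G0 : C -> D)
    (F : functor C D F0) (eta : forall a, hom (F0 a) (G0 a))
    (eps : forall a, hom (G0 a) (F0 a)) :
  (forall a, comp (eps a) (eta a) = idc (F0 a)) ->
  (forall a, comp (eta a) (eps a) = idc (G0 a)) ->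
  exists2 G : functor C D G0, nat_iso F G &
    forall a b (f : hom a b), fmap G f = comp (eta b) (comp (fmap F f) (eps a)).
Proof.
move=> etaK epsK.
have G1 a : comp (eta a) (comp (fmap F (idc a)) (eps a)) = idc (G0 a).
  by rewrite fmap1 comp1c epsK.
have GM a b c (f : hom b c) (g : hom a b) :
    comp (eta c) (comp (fmap F (comp f g)) (eps a)) =
    comp (comp (eta c) (comp (fmap F f) (eps b)))
         (comp (eta b) (comp (fmap F g) (eps a))).
  rewrite fmapM -!compcA; congr (comp _ (comp _ _)).
  by rewrite (compcA (eps b)) etaK comp1c.
exists (@Functor C D G0
  (fun a b f => comp (eta b) (comp (fmap F f) (eps a))) G1 GM) => //.
exists eta; split=> [a b f|a] /=.
  by rewrite -!compcA etaK compc1.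
by exists (eps a).
Qed.

(** * Infima, suprema and order isomorphisms *)

Definition set_type_elt (T : Type) (S : set T) x (Sx : S x) : S :=
  exist _ x (mem_set Sx).


Section bounds.
Context {d : Order.disp_t} {T : porderType d}.
Implicit Types (S : set T) (a b m : T).

Lemma infimumsP S m :
  infimums S m <-> forall x, (x <= m) <-> (forall s, S s -> x <= s).
Proof.
split=> [[ml mg] x|H].
  split=> [xm s Ss|]; first exact: le_trans xm (ml _ Ss).
  exact: mg.
by split=> [|x] /=; [apply/H|move=> lx; apply/H].
Qed.

Lemma supremumsP S m :
  supremums S m <-> forall x, (m <= x) <-> (forall s, S s -> s <= x).
Proof.
split=> [[mu ml] x|H].
  split=> [mx s Ss|]; first exact: le_trans (mu _ Ss) mx.
  exact: ml.
by split=> [|x] /=; [apply/H|move=> ux; apply/H].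
Qed.

Lemma infimums2P a b m :
  infimums [set a; b] m <-> forall x, (x <= m) = (x <= a) && (x <= b).
Proof.
rewrite infimumsP; split=> H x.
  apply/idP/andP=> [/H lx|[xa xb]]; first by split; apply: lx; [left|right].
  by apply/H => s [->|->].
rewrite H; split=> [/andP [xa xb] s [->|->] //|lx].
by rewrite !lx //; [right|left].
Qed.

Lemma infimums_unique S m m' : infimums S m -> infimums S m' -> m = m'.
Proof.
move=> /infimumsP H /infimumsP H'; apply/le_anti/andP.
by split; [apply/H'/H|apply/H/H'].
Qed.

Lemma infimums0P m : infimums set0 m <-> forall x, x <= m.
Proof.
by rewrite infimumsP; split=> H x; [apply/H|split].
Qed.

Lemma directed_finite (D S : set T) :
  D !=set0 -> directed D -> finite_set S -> S `<=` D ->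
  exists2 z, D z & forall s, S s -> s <= z.
Proof.
move=> [z0 Dz0] Ddir /finite_seqP [l ->].
elim: l => [_|a l IHl sD]; first by exists z0.
have [z Dz zl] := IHl (fun x xl => sD x (mem_behead (s := a :: l) xl)).
have [w [Dw zw aw]] := Ddir z a Dz (sD a (mem_head a l)).
exists w => // s; rewrite /= inE => /predU1P [->//|/zl sz].
exact: le_trans sz zw.
Qed.

End bounds.

Definition order_iso d d' (T : porderType d) (T' : porderType d')
    (f : T -> T') : Prop :=
  (forall x y, (f x <= f y) = (x <= y)) /\ (forall y, exists x, f x = y).

Section order_isomorphisms.
Context {d d' : Order.disp_t} {T : porderType d} {T' : porderType d'}.
Variable f : T -> T'.
Hypothesis fiso : order_iso f.

Lemma order_iso_bij : exists g, [/\ cancel f g, cancel g f & order_iso g].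
Proof.
have [fle fsurj] := fiso.
have [g gK] := choice fsurj.
have fK : cancel f g by move=> x; apply/le_anti; rewrite -!fle gK lexx.
exists g; split=> //; split=> [x y|x]; first by rewrite -fle !gK.
by exists (f x).
Qed.

Lemma order_iso_infimums S m : infimums (f @` S) (f m) <-> infimums S m.
Proof.
have [fle fsurj] := fiso; rewrite !infimumsP; split=> H x.
  rewrite -fle H; split=> [Hx s Ss|Hx _ [s Ss <-]]; last by rewrite fle Hx.
  by rewrite -fle; apply: Hx; exists s.
have [{}x <-] := fsurj x; rewrite fle H; split=> [Hx _ [s Ss <-]|Hx s Ss].
  by rewrite fle Hx.
by rewrite -fle; apply: Hx; exists s.
Qed.

Lemma order_iso_supremums S m : supremums (f @` S) (f m) <-> supremums S m.
Proof.
have [fle fsurj] := fiso; rewrite !supremumsP; split=> H x.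
  rewrite -fle H; split=> [Hx s Ss|Hx _ [s Ss <-]]; last by rewrite fle Hx.
  by rewrite -fle; apply: Hx; exists s.
have [{}x <-] := fsurj x; rewrite fle H; split=> [Hx _ [s Ss <-]|Hx s Ss].
  by rewrite fle Hx.
by rewrite -fle; apply: Hx; exists s.
Qed.

Lemma order_iso_infimums2 a b m :
  infimums [set f a; f b] (f m) <-> infimums [set a; b] m.
Proof. by rewrite -order_iso_infimums image_setU !image_set1. Qed.

Lemma order_iso_implication a b c :
  is_implication (f a) (f b) (f c) <-> is_implication a b c.
Proof.
have [fle fsurj] := fiso; split=> H x m.
  by move=> /order_iso_infimums2 /H; rewrite !fle.
have [{}x <-] := fsurj x; have [{}m <-] := fsurj m.
by rewrite order_iso_infimums2 !fle; apply: H.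
Qed.

Lemma order_iso_compact k : compact_element (f k) <-> compact_element k.
Proof.
have [fle fsurj] := fiso; have [g [fK gK giso]] := order_iso_bij.
split=> H S s.
  rewrite -order_iso_supremums -fle => /H {}H /H [S' [t [S'fin sS' S't kt]]].
  exists (g @` S'), (g t); split.
  - exact: finite_image.
  - by move=> _ [x /sS' [y Sy <-] <-]; rewrite fK.
  - rewrite -order_iso_supremums gK image_comp.
    by rewrite (_ : f \o g = id) ?image_id //; apply/funext => x /=; rewrite gK.
  - by rewrite -fle gK.
rewrite -[s]gK fle => Ss /(H (g @` S)) [].
  rewrite -order_iso_supremums image_comp.
  by rewrite (_ : f \o g = id) ?image_id //; apply/funext => x /=; rewrite gK.
move=> S' [t [S'fin sS' S't kt]].
exists (f @` S'), (f t); split.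
- exact: finite_image.
- by move=> _ [x /sS' [y Sy <-] <-]; rewrite gK.
- by rewrite order_iso_supremums.
- by rewrite fle.
Qed.

End order_isomorphisms.

(** * Brouwerian semilattices *)

(* In a poset without chosen meets, "z <= a and z <= x imply z <= b" says that
   the meet of a and x is below b. *)
Lemma is_brouwerianP d (A : porderType d) :
  (exists t : A, forall x, x <= t) ->
  (forall a b : A, exists m, forall x, (x <= m) = (x <= a) && (x <= b)) ->
  (forall a b : A, exists c, forall x,
     (x <= c) <-> (forall z, z <= a -> z <= x -> z <= b)) ->
  is_brouwerian A.
Proof.
move=> [t tP] meetP impP; split=> [S /finite_seqP [l ->]|a b].
  elim: l => [|a l [m /infimumsP mP]].
    by exists t; apply/infimumsP => x; split.
  have [n nP] := meetP a m; exists n; apply/infimumsP => x.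
  rewrite nP; split=> [/andP [xa /mP xl] s|xl].
    by rewrite /= inE => /predU1P [->//|]; apply: xl.
  apply/andP; split; first by apply: xl; rewrite /= mem_head.
  by apply/mP => s sl; apply: xl; rewrite /= inE sl orbT.
have [c cP] := impP a b; exists c => x m /infimums2P mP.
apply/idP/idP => [/cP xc|mb].
  by move: (lexx m); rewrite mP => /andP [ma mx]; apply: xc.
by apply/cP => z za zx; apply: le_trans mb; rewrite mP za zx.
Qed.

Section brouwerian.
Context {d : Order.disp_t} {A : porderType d}.
Hypothesis brwA : is_brouwerian A.
Implicit Types (a b c x y : A) (F G P : set A).

(** [is_brouwerian] only asserts that meets and implications exist; they are chosen here, and
    antisymmetry makes the choice immaterial. *)
Definition meet_of a b : A :=
  sval (cid (brwA.1 [set a; b] (finite_set2 a b))).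

Definition top_of : A := sval (cid (brwA.1 set0 (finite_set0 A))).

Definition imp_of a b : A := sval (cid (brwA.2 a b)).

Lemma infimums_meet_of a b : infimums [set a; b] (meet_of a b).
Proof. by rewrite /meet_of; case: cid. Qed.

Lemma le_meet_of x a b : (x <= meet_of a b) = (x <= a) && (x <= b).
Proof. exact: (infimums2P a b _).1 (infimums_meet_of a b) x. Qed.

Lemma meet_of_le a b : (meet_of a b <= a) * (meet_of a b <= b).
Proof. by have := lexx (meet_of a b); rewrite le_meet_of => /andP []. Qed.

Lemma le_top_of x : x <= top_of.
Proof. by rewrite /top_of; case: cid => t /= /infimums0P. Qed.

Lemma is_implication_imp_of a b : is_implication a b (imp_of a b).
Proof. by rewrite /imp_of; case: cid. Qed.

Lemma le_imp_of x a b : (x <= imp_of a b) = (meet_of a x <= b).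
Proof. exact: is_implication_imp_of (infimums_meet_of a x). Qed.

(** Modus ponens below a common lower bound [c], which spares computations with nested meets. *)
Lemma meet_imp_of a b c : c <= imp_of a b -> c <= a -> c <= b.
Proof.
by rewrite le_imp_of => cb ca; apply: le_trans cb; rewrite le_meet_of ca lexx.
Qed.

Lemma le_imp_ofr a b : b <= imp_of a b.
Proof. by rewrite le_imp_of meet_of_le. Qed.

Lemma is_filterP F :
  is_filter F <-> [/\ upset F, F top_of &
                      forall a b, F a -> F b -> F (meet_of a b)].
Proof.
split=> [[Fup Fm]|[Fup Ft Fm]].
  split=> //.
    apply: (Fm set0) => //; apply/infimums0P; exact: le_top_of.
  move=> a b Fa Fb; apply: (Fm [set a; b]); last exact: infimums_meet_of.
    exact: finite_set2.
  by move=> x [->|->].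
split=> // S m /finite_seqP [l ->] lF /infimumsP mP.
suff [c [Fc cl]] : exists c, F c /\ forall s, s \in l -> c <= s.
  by apply: Fup Fc _; apply/mP.
elim: l lF {mP} => [_|a l IHl lF]; first by exists top_of.
have [s sl|c [Fc cl]] := IHl; first by apply: lF; rewrite /= inE sl orbT.
exists (meet_of a c); split; first by apply: Fm => //; apply: lF;
  rewrite /= mem_head.
move=> s; rewrite inE => /predU1P [->|/cl cs]; first by rewrite meet_of_le.
by apply: le_trans cs; rewrite meet_of_le.
Qed.

Lemma filter_top F : is_filter F -> F top_of.
Proof. by move=> /is_filterP []. Qed.

Lemma filter_meet F a b : is_filter F -> F a -> F b -> F (meet_of a b).
Proof. by move=> /is_filterP [_ _]; apply. Qed.

Lemma filter_upset F : is_filter F -> upset F.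
Proof. by case. Qed.

Lemma filter_principal a : is_filter [set x | a <= x].
Proof.
apply/is_filterP; split=> [x y /= ax|/=|x y /= ax ay].
- exact: le_trans.
- exact: le_top_of.
- by rewrite le_meet_of ax.
Qed.

Lemma filter_setT : is_filter [set: A].
Proof. by apply/is_filterP; split. Qed.

Lemma filter_bigcap (I : Type) (D : set I) (F : I -> set A) :
  (forall i, D i -> is_filter (F i)) -> is_filter (\bigcap_(i in D) F i).
Proof.
move=> Ff; apply/is_filterP; split=> [x y Fx xy i Di|i Di|a b Fa Fb i Di].
- exact: filter_upset (Ff _ Di) _ _ (Fx _ Di) xy.
- exact: filter_top (Ff _ Di).
- exact: filter_meet (Ff _ Di) (Fa _ Di) (Fb _ Di).
Qed.

Lemma filter_setI F G : is_filter F -> is_filter G -> is_filter (F `&` G).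
Proof.
move=> Ff Gf; have -> : F `&` G = \bigcap_(b in [set: bool]) (if b then F else
  G).
  apply/seteqP; split=> [x [Fx Gx] [] //|x FGx].
  by split; [exact: (FGx true)|exact: (FGx false)].
by apply: filter_bigcap => -[].
Qed.

Definition filter_add F a : set A := [set x | exists2 f,
  F f & meet_of f a <= x].

Lemma filter_filter_add F a : is_filter F -> is_filter (filter_add F a).
Proof.
move=> Ff; apply/is_filterP; split=> [x y [f Ff' fx] xy||x y [f Ff' fx] [g Fg
  gy]].
- by exists f => //; exact: le_trans xy.
- by exists top_of; [exact: filter_top|exact: le_top_of].
- exists (meet_of f g); first exact: filter_meet.
  rewrite le_meet_of; apply/andP; split; [apply: le_trans fx|apply: le_trans
    gy];
  by rewrite !le_meet_of ?(le_trans (meet_of_le _ _).1 (meet_of_le _ _).1)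
    ?(le_trans (meet_of_le _ _).1 (meet_of_le _ _).2) (meet_of_le _ _).2.
Qed.

Lemma sub_filter_add F a : F `<=` filter_add F a.
Proof. by move=> f Ff; exists f => //; rewrite meet_of_le. Qed.

Lemma filter_add_mem F a : is_filter F -> filter_add F a a.
Proof. by exists top_of; [exact: filter_top|rewrite meet_of_le]. Qed.

(** The deduction theorem for filters. *)
Lemma filter_addP F a x : is_filter F -> filter_add F a x <-> F (imp_of a x).
Proof.
move=> Ff; split=> [[f Ff' fx]|Fi].
  apply: (filter_upset Ff Ff'); rewrite le_imp_of; apply: le_trans fx.
  by rewrite le_meet_of !meet_of_le.
exists (imp_of a x) => //.
by apply: (@meet_imp_of a); rewrite meet_of_le.
Qed.

(* The Heyting implication of the frame of filters. *)
Lemma filter_arrow F G : is_filter F -> is_filter G ->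
  is_filter [set a | forall f, F f -> a <= f -> G f].
Proof.
move=> Ff Gf; apply/is_filterP; split=> [a b aFG ab f Ff' bf|f Ff' tf|a b aFG
  bFG f Ff' abf].
- exact: aFG (le_trans ab bf).
- exact: filter_upset Gf _ _ (filter_top Gf) tf.
(* Both [b -> f] and [(b -> f) -> f] are above [f], hence in [F]; [a] is below the first and [b]
   below the second, so [G] contains both and, by modus ponens, [f]. *)
- have Gbf : G (imp_of b f).
    apply: aFG; first exact: filter_upset Ff _ _ Ff' (le_imp_ofr b f).
    rewrite le_imp_of; apply: le_trans abf.
    by rewrite le_meet_of !meet_of_le.
  have Gbff : G (imp_of (imp_of b f) f).
    apply: bFG; first exact: filter_upset Ff _ _ Ff' (le_imp_ofr _ f).
    rewrite le_imp_of; apply: (@meet_imp_of b); rewrite meet_of_le //.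
  apply: filter_upset Gf _ _ (filter_meet Gf Gbff Gbf) _.
  by apply: meet_imp_of (meet_of_le _ _).1 (meet_of_le _ _).2.
Qed.

(** * Prime and optimal filters *)

Lemma infimums_filters2 (F G H : @filters _ A) :
  infimums [set F; G] H <-> val H = val F `&` val G.
Proof.
have FGf := filter_setI (set_valP F) (set_valP G).
pose FG : @filters _ A := set_type_elt FGf.
have FGP : infimums [set F; G] FG.
  apply/infimums2P => x; apply/idP/andP.
    rewrite -[x <= FG]/(val x <= val F `&` val G) -[x <= F]/(val x <= val F)
      -[x <= G]/(val x <= val G) !subsetEset.
    by move=> xFG; split=> y /xFG [].
  rewrite -[x <= FG]/(val x <= val F `&` val G) -[x <= F]/(val x <= val F)
      -[x <= G]/(val x <= val G) !subsetEset.
  by move=> [xF xG] y xy; split; [apply: xF|apply: xG].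
split=> [HP|HE]; first by rewrite (infimums_unique HP FGP).
by have -> : H = FG by apply: val_inj.
Qed.

(** Meet-primeness is tested on the principal filters of [a] and [b]: their intersection is the set
    of common upper bounds, so it fails to be contained in [P] exactly when some common upper bound
    lies outside [P]. *)
Lemma prime_filterP P :
  prime_filter P <-> [/\ is_filter P, P <> setT & directed (~` P)].
Proof.
split=> [[Q <- [Qtop Qp]]|[Pf Pn Pd]].
  split; first exact: set_valP.
    move=> QT; apply: Qtop => x; change (val x <= val Q).
    by rewrite QT subsetEset.
  move=> a b /= nQa nQb.
  pose up c : @filters _ A := set_type_elt (filter_principal c).
  pose m : @filters _ A := set_type_elt
    (filter_setI (filter_principal a) (filter_principal b)).
  have mP : infimums [set up a; up b] m by apply/infimums_filters2.
  have [[c [ac bc nQc]]|abQ] := pselect (exists c, [/\ a <= c,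
    b <= c & ~ val Q c]).
    by exists c.
  have /(Qp _ _ _ mP) [] : m <= Q.
  - change (val m <= val Q); rewrite subsetEset => c [/= ac bc].
    by apply: contrapT => nQc; apply: abQ; exists c.
  - change (val (up a) <= val Q -> exists z, [/\ ~ val Q z, a <= z & b <= z]).
    by rewrite subsetEset => /(_ a (lexx a)).
  - change (val (up b) <= val Q -> exists z, [/\ ~ val Q z, a <= z & b <= z]).
    by rewrite subsetEset => /(_ b (lexx b)).
pose Q : @filters _ A := set_type_elt Pf.
exists Q => //; split.
  move=> Qtop; apply: Pn; apply/seteqP; split=> // x _.
  have := Qtop (set_type_elt filter_setT).
  by change (([set: A] <= P) -> P x); rewrite subsetEset; apply.
move=> F G H /infimums_filters2 HE.
change (val H <= P -> val F <= P \/ val G <= P).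
rewrite HE !subsetEset => FGP.
have [|/existsNP [a /not_implyP [Fa nPa]]] := pselect (val F `<=` P);
  first by left.
right=> b Gb; apply: contrapT => nPb; have [c [nPc ac bc]] := Pd _ _ nPa nPb.
apply: nPc; apply: FGP; split.
  exact: filter_upset (set_valP F) _ _ Fa ac.
exact: filter_upset (set_valP G) _ _ Gb bc.
Qed.

Lemma prime_filter_filter P : prime_filter P -> is_filter P.
Proof. by move=> /prime_filterP []. Qed.

(** Properness makes the complement nonempty, which settles the case of an empty [S]. *)
Lemma prime_filter_avoid P S : prime_filter P -> finite_set S -> S `<=` ~` P ->
  exists2 c, ~ P c & forall s, S s -> s <= c.
Proof.
move=> /prime_filterP [Pf Pn Pd] Sfin SP; apply: directed_finite (Pd) Sfin SP.
by apply/set0P/eqP => P0; apply: Pn; rewrite -[P]setCK P0 setC0.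
Qed.

(** Zorn's lemma gives a filter maximal among those containing [F] and disjoint from [D];
    implication and the directedness of [D] make its complement directed. *)
Lemma prime_filter_extension F (D : set A) :
  is_filter F -> D !=set0 -> directed D -> F `&` D = set0 ->
  exists P, [/\ prime_filter P, F `<=` P & P `&` D = set0].
Proof.
move=> Ff [d0 Dd0] Dd FD.
pose good G := is_filter G /\ G `&` D = set0.
have [C Cgood Ctot|M [[Mf MD] Mmax]] := @Zorn_bigcup A [set G | good (F `|` G)].
  (* F itself is added to the chain, so that the empty chain needs no care. *)
  pose C' := [set F `|` G | G in set0 |` C].
  have C'good G : C' G -> good G.
    by move=> [H [->|CH] <-]; [rewrite setU0|exact: Cgood].
  have C'dir G H : C' G -> C' H -> exists2 K, C' K & G `|` H `<=` K.
    move=> [G' CG <-] [H' CH <-].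
    have [GH|HG] : G' `<=` H' \/ H' `<=` G'.
    - case: CG CH => [->|CG] [->|CH]; [by left|by left|by right|].
      exact: Ctot.
    - exists (F `|` H'); first by exists H'.
      by move=> x [[|/GH]|[|]]; by [left|right].
    - exists (F `|` G'); first by exists G'.
      by move=> x [[|]|[|/HG]]; by [left|right].
  change (good (F `|` \bigcup_(X in C) X)).
  have -> : F `|` \bigcup_(X in C) X = \bigcup_(G in C') G.
    apply/seteqP; split=> [x [Fx|[G CG Gx]]|x [_ [G [->|CG] <-]]].
    - by exists (F `|` set0); [exists set0; [left|]|left].
    - by exists (F `|` G); [exists G; [right|]|right].
    - by rewrite setU0; left.
    - by move=> [Fx|Gx]; [left|right; exists G].
  have C'F : C' F by exists set0; [left|rewrite setU0].
  split; last first.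
    rewrite -subset0 => x [[G /C'good [_ GD] Gx] Dx].
    by rewrite -GD; split.
  apply/is_filterP; split=> [x y [G C'G Gx] xy||a b [G C'G Ga] [H C'H Hb]].
  - by exists G => //; apply: filter_upset xy => //; case: (C'good _ C'G).
  - by exists F => //; exact: filter_top.
  - have [K C'K GHK] := C'dir _ _ C'G C'H.
    exists K => //; have [Kf _] := C'good _ C'K.
    by apply: filter_meet => //; apply: GHK; [left|right].
(* By maximality the filter generated by [a] and the maximal filter meets [D] in some [e]; the
   deduction theorem then puts [a -> e] in the maximal filter. *)
have {Mmax} maxM a : ~ (F `|` M) a -> exists2 e, D e & (F `|` M) (imp_of a e).
  move=> nMa; apply: contrapT => nD.
  apply: (Mmax (filter_add (F `|` M) a)).
    split; last by move=> /(_ a (filter_add_mem a Mf)) Ma; apply: nMa; right.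
    by move=> x Mx; apply: sub_filter_add; right.
  have FM : F `|` filter_add (F `|` M) a = filter_add (F `|` M) a.
    by apply/setUidPr => x Fx; apply: sub_filter_add; left.
  rewrite /= FM; split; first exact: filter_filter_add.
  rewrite -subset0 => x [/filter_addP xM Dx]; apply: nD.
  by exists x => //; apply: xM.
exists (F `|` M); split; [|by left|exact: MD].
apply/prime_filterP; split=> //.
  by move=> MT; have : set0 d0 by rewrite -MD MT.
move=> a b /maxM [e De Mae] /maxM [e' De' Mbe].
have [c [Dc ec ec']] := Dd _ _ De De'.
have {Mae}Mac : (F `|` M) (imp_of a c).
  apply: (filter_upset Mf Mae); rewrite le_imp_of; apply: le_trans ec.
  by apply: (@meet_imp_of a); rewrite meet_of_le.
have {Mbe}Mbc : (F `|` M) (imp_of b c).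
  apply: (filter_upset Mf Mbe); rewrite le_imp_of; apply: le_trans ec'.
  by apply: (@meet_imp_of b); rewrite meet_of_le.
(* The element [p -> c] plays the part of a join of [a] and [b]: both are below it by modus ponens,
   and if it were in the filter, so would be [c], which lies in [D]. *)
pose p := meet_of (imp_of a c) (imp_of b c).
have Mp : (F `|` M) p by exact: filter_meet.
exists (imp_of p c); split.
- move=> Mpc; have : set0 c; last by [].
  rewrite -MD; split=> //; apply: (filter_upset Mf (filter_meet Mf Mp Mpc)).
  exact: meet_imp_of (meet_of_le _ _).2 (meet_of_le _ _).1.
- rewrite le_imp_of; apply: (@meet_imp_of a); last by rewrite meet_of_le.
  by apply: le_trans (meet_of_le _ _).1 _; rewrite /p meet_of_le.
- rewrite le_imp_of; apply: (@meet_imp_of b); last by rewrite meet_of_le.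
  by apply: le_trans (meet_of_le _ _).1 _; rewrite /p meet_of_le.
Qed.

Lemma directed1 a : directed [set a].
Proof. by move=> _ _ -> ->; exists a. Qed.

Lemma prime_filter_separation F a : is_filter F -> ~ F a ->
  exists P, [/\ prime_filter P, F `<=` P & ~ P a].
Proof.
move=> Ff nFa.
have [| |P [Pp FP Pa]] := prime_filter_extension Ff _ (@directed1 a).
- by exists a.
- by rewrite -subset0 => x [Fx xa]; apply: nFa; rewrite -xa.
- by exists P; split=> // Pa'; have : set0 a by rewrite -Pa.
Qed.

Lemma prime_filter_le a b : ~~ (a <= b) ->
  exists P, [/\ prime_filter P, P a & ~ P b].
Proof.
move=> /negP nab; have [P [Pp aP nPb]] :=
  prime_filter_separation (filter_principal a) nab.
by exists P; split=> //; apply: aP => /=.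
Qed.

Lemma prime_filter_optimal P : prime_filter P -> optimal_filter P.
Proof.
move=> Pp; split; first exact: prime_filter_filter.
move=> S Sfin SP t tS Pt; have [c nPc Sc] := prime_filter_avoid Pp Sfin SP.
by apply: nPc; apply: (filter_upset (prime_filter_filter Pp) Pt); apply: tS.
Qed.

Lemma optimal_filterP F : optimal_filter F <-> is_filter F /\ (forall S t,
  finite_set S -> S `<=` ~` F -> F t ->
     exists2 u, ubound S u & ~~ (t <= u)).
Proof.
split=> [[Ff FC]|[Ff FC]]; split=> // S.
  move=> t Sfin SF Ft; apply: contrapT => nu; apply: (FC S Sfin SF t) => //.
  move=> u Su; apply/negPn/negP => tu; apply: nu; by exists u.
move=> Sfin SF t tS Ft; have [u Su] := FC S t Sfin SF Ft.
by rewrite tS.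
Qed.

(** Optimality gives an upper bound [u] of [S] with [t] not below [u]; a prime filter containing [t]
    but not [u] avoids all of [S]. In terms of basic open sets this is the density of the prime
    filters. *)
Lemma prime_filters_dense F S t : optimal_filter F -> F t -> finite_set S ->
  S `<=` ~` F -> exists P, [/\ prime_filter P, P t & S `<=` ~` P].
Proof.
move=> /optimal_filterP [Ff FC] Ft Sfin SF; have [u Su tu] := FC S t Sfin SF Ft.
have [P [Pp Pt nPu]] := prime_filter_le tu.
exists P; split=> // s /Su su Ps; apply: nPu.
exact: filter_upset (prime_filter_filter Pp) _ _ Ps su.
Qed.

Lemma optimal_or_full_filter F : @optimal_or_full _ A F -> is_filter F.
Proof. by move=> [[]//|->]; exact: filter_setT. Qed.

End brouwerian.

(** * Posets isomorphic to a frame of filters *)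

(** An isomorphism of posets from [L] to the filters of [A], given through the plain sets [e x]. It
    is instantiated with the poset of filters itself, with a Brouwerian frame over the dual of its
    compact elements, and with the admissible closed upsets of a space. *)
Definition filter_repr d d' (A : porderType d) (L : porderType d')
    (e : L -> set A) : Prop :=
  [/\ forall x y, (x <= y) <-> e x `<=` e y, forall x, is_filter (e x) &
      forall F, is_filter F -> exists x, e x = F].

Section filter_repr.
Context {d d' : Order.disp_t} {A : porderType d} {L : porderType d'}.
Variable e : L -> set A.
Hypotheses (brwA : is_brouwerian A) (er : filter_repr e).
Implicit Types (a b : A) (x y : L) (S : set L).

Lemma filter_repr_le x y : (x <= y) <-> e x `<=` e y.
Proof. by case: er. Qed.

Lemma filter_repr_filter x : is_filter (e x).
Proof. by case: er. Qed.

Lemma filter_repr_surj F : is_filter F -> exists x, e x = F.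
Proof. by case: er => _ _; apply. Qed.

Lemma filter_repr_inj : injective e.
Proof.
move=> x y exy; apply/le_anti/andP.
by split; apply/filter_repr_le; rewrite exy.
Qed.

Lemma filter_repr_infimums S m : infimums S m <-> e m = \bigcap_(x in S) e x.
Proof.
have [n nE] := filter_repr_surj
  (filter_bigcap brwA (D := S) (fun x _ => filter_repr_filter x)).
have nP : infimums S n.
  apply/infimumsP => x; rewrite filter_repr_le nE; split=> [xS s Ss|xS].
    by apply/filter_repr_le => a /xS; apply.
  by move=> a xa s /xS /filter_repr_le; apply.
split=> [mP|mE]; first by rewrite (infimums_unique mP nP).
by rewrite (_ : m = n) //; apply: filter_repr_inj; rewrite mE nE.
Qed.

Lemma filter_repr_infimums2 x y m :
  infimums [set x; y] m <-> e m = e x `&` e y.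
Proof. by rewrite filter_repr_infimums bigcap_setU !bigcap_set1. Qed.

Lemma filter_repr_supremums_ex S : supremums S !=set0.
Proof.
have [s sE] := filter_repr_surj (filter_bigcap brwA
  (D := [set x | ubound S x]) (fun x _ => filter_repr_filter x)).
exists s; apply/supremumsP => x; split=> [sx y Sy|Sx].
  apply: le_trans sx; apply/filter_repr_le => a ya.
  by rewrite sE => z /(_ y Sy) /filter_repr_le; apply.
by apply/filter_repr_le; rewrite sE => a; apply.
Qed.

(** The elements lying in the join of some finite subset of [S] form a filter that includes [e x]
    for every [x] in [S], hence includes [e s]. *)
Lemma filter_repr_supremums_mem S s a : supremums S s -> e s a ->
  exists S' t, [/\ finite_set S', S' `<=` S, supremums S' t & e t a].
Proof.
move=> /supremumsP sP; pose G := [set a | exists S' t,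
  [/\ finite_set S', S' `<=` S, supremums S' t & e t a]].
suff Gf : is_filter G.
  have [g gE] := filter_repr_surj Gf.
  have /filter_repr_le : s <= g; last by rewrite gE; apply.
  apply/sP => x Sx; apply/filter_repr_le; rewrite gE => b xb.
  exists [set x], x; rewrite supremums1; split=> //.
  by move=> _ ->.
apply/(is_filterP brwA); split.
- move=> b c [S' [t [S'fin S'S S't tb]]] bc; exists S', t; split=> //.
  exact: filter_upset (filter_repr_filter t) _ _ tb bc.
- have [t t0] := filter_repr_supremums_ex set0.
  by exists set0, t; split=> //; exact: (filter_top brwA (filter_repr_filter
    t)).
- move=> b c [S1 [t1 [S1fin S1S /supremumsP S1t t1b]]].
  move=> [S2 [t2 [S2fin S2S /supremumsP S2t t2b]]].
  have [t St] := filter_repr_supremums_ex (S1 `|` S2).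
  exists (S1 `|` S2), t; split=> //.
  + by rewrite finite_setU.
  + by move=> x [/S1S|/S2S].
  + move: St => /supremumsP St; apply: (filter_meet brwA (filter_repr_filter
      t)).
      have /filter_repr_le : t1 <= t; last exact.
      by apply/S1t => x Sx; apply: (St t).1 => //; left.
    have /filter_repr_le : t2 <= t; last exact.
    by apply/S2t => x Sx; apply: (St t).1 => //; right.
Qed.

(** A filter is the directed join of the principal filters of its elements, so a compact one equals
    one of these. Conversely, the generator of a principal filter below a join already lies in a
    finite subjoin. *)
Lemma filter_repr_compactP k :
  compact_element k <-> exists a, e k = [set x | a <= x].
Proof.
split=> [kc|[a kE] S s Ss /filter_repr_le]; last first.
  rewrite kE => /(_ a (lexx a)) /(filter_repr_supremums_mem Ss).
  move=> [S' [t [S'fin S'S S't ta]]]; exists S', t; split=> //.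
  apply/filter_repr_le; rewrite kE => x.
  exact: filter_upset (filter_repr_filter t) _ _ ta.
have [p pE] := choice (fun a => filter_repr_surj (filter_principal brwA a)).
have p_le a x : p a <= x <-> e x a.
  rewrite filter_repr_le pE; split=> [|xa y]; first by apply => /=.
  exact: filter_upset (filter_repr_filter x) _ _ xa.
pose S := [set p a | a in e k].
have Sk : supremums S k.
  apply/supremumsP => x; split=> [kx _ [a ka <-]|Sx].
    by apply/p_le; move/filter_repr_le : kx; apply.
  by apply/filter_repr_le => a ka; apply/p_le; apply: Sx; exists a.
have [S' [t [S'fin S'S S't kt]]] := kc S k Sk (lexx k).
have [||_ [a ka <-] pS'] := directed_finite _ _ S'fin S'S.
- exists (p (top_of brwA)), (top_of brwA) => //.
  exact: (filter_top brwA (filter_repr_filter _)).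
- move=> _ _ [a ka <-] [b kb <-]; exists (p (meet_of brwA a b)); split.
  + exists (meet_of brwA a b) => //; exact: (filter_meet brwA
      (filter_repr_filter k)).
  + by apply/p_le; rewrite pE /= meet_of_le.
  + by apply/p_le; rewrite pE /= meet_of_le.
exists a; rewrite -pE; congr e; apply/le_anti/andP; split; last exact/p_le.
apply: le_trans kt _; move/supremumsP : S't => S't.
exact/S't.
Qed.

Lemma filter_repr_is_frame : is_frame L.
Proof.
split=> [S|a S s m Ss /filter_repr_infimums2 mE];
  first exact: filter_repr_supremums_ex.
apply/supremumsP => y; split=> [my x [b Sb /filter_repr_infimums2 xE]|xy].
  apply: le_trans my; apply/filter_repr_le; rewrite xE mE => c [ac bc];
    split=> //.
  by move/supremumsP : Ss => /(_ s) [/(_ (lexx s) _ Sb) /filter_repr_le bs _];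
    apply: bs.
(* [w] is the implication from [a] to [y] in the frame of filters; infinite distributivity holds
   because meeting with [a] has this right adjoint. *)
have [w wE] := filter_repr_surj
  (filter_arrow brwA (filter_repr_filter a) (filter_repr_filter y)).
have /filter_repr_le sw : s <= w.
  move/supremumsP : Ss => -> b Sb; apply/filter_repr_le.
  rewrite wE => c bc f af cf.
  have [x xE] := filter_repr_surj
    (filter_setI brwA (filter_repr_filter a) (filter_repr_filter b)).
  have /filter_repr_le xy' : x <= y by apply: xy; exists b => //;
    apply/filter_repr_infimums2.
  apply: xy'; rewrite xE; split=> //.
  exact: filter_upset (filter_repr_filter b) _ _ bc cf.
apply/filter_repr_le; rewrite mE => c [ac /sw].
by rewrite wE; apply.
Qed.

Lemma filter_repr_is_algebraic : is_algebraic L.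
Proof.
move=> x; exists [set k | compact_element k /\ k <= x]; first by move=> k [].
apply/supremumsP => y; split=> [xy k [_ kx]|kx]; first exact: le_trans xy.
apply/filter_repr_le => a xa.
have [k kE] := filter_repr_surj (filter_principal brwA a).
have /filter_repr_le : k <= y; last by apply; rewrite kE /=.
apply: kx; split; first by apply/filter_repr_compactP; exists a.
apply/filter_repr_le; rewrite kE => b ab.
exact: filter_upset (filter_repr_filter x) _ _ xa ab.
Qed.

Lemma filter_repr_compacts : exists p : A -> compacts_dual L,
  order_iso p /\ forall a, e (val (p a : @compacts _ L)) = [set x | a <= x].
Proof.
have [p pE] := choice (fun a => filter_repr_surj (filter_principal brwA a)).
have pc a : compact_element (p a) by apply/filter_repr_compactP; exists a.
exists (fun a => set_type_elt (pc a) : compacts_dual L); split=> //; split.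
  move=> a b; apply/idP/idP.
    by change (p b <= p a -> a <= b) => /filter_repr_le; rewrite !pE;
      apply=> /=.
  change (a <= b -> p b <= p a) => ab; apply/filter_repr_le; rewrite !pE => x.
  exact: le_trans.
move=> [k kc]; have /filter_repr_compactP [a aE] := set_mem kc.
exists a; apply: val_inj => /=.
by apply: filter_repr_inj; rewrite pE aE.
Qed.

End filter_repr.

Lemma is_brouwerian_iso d d' (A : porderType d) (B : porderType d') (f : A ->
  B) :
  order_iso f -> is_brouwerian A -> is_brouwerian B.
Proof.
move=> fiso brwA; have [g [fK gK giso]] := order_iso_bij fiso;
  split=> [S Sfin|a b].
  have [m Sm] := brwA.1 (g @` S) (finite_image _ Sfin).
  by exists (f m); rewrite /= -(order_iso_infimums giso) fK.
have [c cP] := brwA.2 (g a) (g b); exists (f c).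
by apply/(order_iso_implication giso); rewrite fK.
Qed.

Lemma filter_repr_is_brouwerian_frame d d' (A : porderType d) (L : porderType
  d')
    (e : L -> set A) :
  is_brouwerian A -> filter_repr e -> is_brouwerian_frame L.
Proof.
move=> brwA er; split.
- exact: filter_repr_is_frame er.
- exact: filter_repr_is_algebraic er.
- have [p [piso _]] := filter_repr_compacts brwA er.
  exact: is_brouwerian_iso piso brwA.
Qed.

Lemma filters_repr d (A : porderType d) :
  filter_repr (fun F : @filters _ A => val F).
Proof.
split=> [F G|F|F Ff]; last by exists (set_type_elt Ff).
  by change (val F <= val G <-> val F `<=` val G); rewrite subsetEset.
exact: set_valP.
Qed.

Lemma F_wf_holds : F_wf.
Proof.
by move=> A; apply: filter_repr_is_brouwerian_frame (brwMSP A) (filters_repr A).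
Qed.

(** * Algebraic frames as frames of filters of compact elements *)

Section compacts.
Context {d : Order.disp_t} {L : porderType d}.
Hypothesis brwL : is_brouwerian_frame L.
Implicit Types (k : compacts_dual L) (x y : L).

(** The dual order turns what is an ideal of compact elements in [L] into a filter. *)
Definition compacts_below x : set (compacts_dual L) :=
  [set k | val (k : @compacts _ L) <= x].

Lemma frame_supremums (S : set L) : supremums S !=set0.
Proof. by case: brwL => -[]. Qed.

Lemma algebraic_le x y : (x <= y) <-> compacts_below x `<=` compacts_below y.
Proof.
split=> [xy k /= kx|xy]; first exact: le_trans xy.
have [_ /(_ x) [S Sc Sx] _] := brwL.
move/supremumsP : (Sx) => Sx'; apply/Sx' => s Ss.
have : compacts_below y (set_type_elt (Sc _ Ss)); last by [].
apply: xy; rewrite /compacts_below /=.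
exact: (Sx' x).1.
Qed.

Lemma compact_supremums0 x : supremums set0 x -> compact_element x.
Proof.
by move=> x0 S s _ _; exists set0, x; split=> //; exact: sub0set.
Qed.

Lemma compact_supremums2 (a b c : L) : compact_element a -> compact_element b ->
  supremums [set a; b] c -> compact_element c.
Proof.
move=> ac bc /supremumsP cP S s Ss cs.
have /cP abs := cs.
have [|S1 [t1 [S1f S1S /supremumsP S1t at1]]] := ac S s Ss; first by apply: abs;
  left.
have [|S2 [t2 [S2f S2S /supremumsP S2t bt2]]] := bc S s Ss; first by apply: abs;
  right.
have [t St] := frame_supremums (S1 `|` S2).
exists (S1 `|` S2), t; split=> //; first by rewrite finite_setU.
  by move=> x [/S1S|/S2S].
move/supremumsP : St => St; apply/cP => _ [->|->].
  apply: le_trans at1 _; apply/S1t => x Sx; apply: (St t).1 => //; by left.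
apply: le_trans bt2 _; apply/S2t => x Sx; apply: (St t).1 => //; by right.
Qed.

Let brwK : is_brouwerian (compacts_dual L).
Proof. by case: brwL. Qed.

(** Closure under meets of the dual holds because a finite join of compact elements is compact: the
    meet of [a] and [b] in the dual lies, in [L], below their join. *)
Lemma compacts_below_filter x : is_filter (compacts_below x).
Proof.
apply/(is_filterP brwK); split.
- move=> a b /= ax ab; apply: le_trans ax.
  exact: ab.
- have [z z0] := frame_supremums set0.
  have /= := le_top_of brwK (set_type_elt (compact_supremums0 z0) :
    compacts_dual L).
  move=> tz; apply: (le_trans (y := z)); first exact: tz.
  by have /supremumsP zP := z0; apply/zP.
- move=> a b ax bx.
  have [c cP] := frame_supremums [set val (a : @compacts _ L);
    val (b : @compacts _ L)].
  have cc := compact_supremums2 (set_valP (a : @compacts _ L)) (set_valP (b :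
    @compacts _ L)) cP.
  have /supremumsP {}cP := cP.
  have := infimums_meet_of brwK a b => /infimums2P /(_ (set_type_elt cc)).
  have [ca cb] : val (a : @compacts _ L) <= c /\ val (b : @compacts _ L) <= c.
    by split; apply: (cP c).1 => //; [left|right].
  have -> : (set_type_elt cc : compacts_dual L) <= a by exact: ca.
  have -> : (set_type_elt cc : compacts_dual L) <= b by exact: cb.
  move=> mc; apply: (le_trans (y := c)); first exact: mc.
  by apply/cP => _ [->|->].
Qed.

Lemma compacts_below_repr : filter_repr compacts_below.
Proof.
split; [exact: algebraic_le|exact: compacts_below_filter|].
(* The element sought is the join of [F] in [L]: a compact element below it is below a finite
   subjoin, hence below a single member of [F], as [F] is closed under meets of the dual. *)
move=> F Ff; have [x xP] := frame_supremums [set val (k : @compacts _ L)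
  | k in F].
exists x; apply/seteqP; split=> [k kx|k Fk]; last first.
  by move/supremumsP : xP => /(_ x) [/(_ (lexx x)) + _]; apply; exists k.
have kc := set_valP (k : @compacts _ L).
have [S [t [Sfin SF St kt]]] := kc _ _ xP kx.
have [| |_ [c Fc <-] Sc] := directed_finite _ _ Sfin SF.
- by exists (val (top_of brwK : @compacts _ L)), (top_of brwK) => //;
    exact: filter_top.
- move=> _ _ [a Fa <-] [b Fb <-]; exists (val (meet_of brwK a b : @compacts _
    L)).
  split; [|exact: (meet_of_le brwK a b).1|exact: (meet_of_le brwK a b).2].
  by exists (meet_of brwK a b) => //; exact: filter_meet.
apply: (filter_upset Ff Fc); apply: (le_trans (y := t)); first exact: kt.
by move/supremumsP : St => St; apply/St.
Qed.

(** A join in the dual is a priori only the greatest compact lower bound; algebraicity makes it the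
    greatest of all lower bounds. *)
Lemma compacts_dual_supremums (S : set (compacts_dual L)) j :
  supremums S j ->
  infimums [set val (k : @compacts _ L) | k in S] (val (j : @compacts _ L)).
Proof.
move=> /supremumsP jP; apply/infimumsP => x; split=> [xj _ [k Sk <-]|xS].
  by apply: (le_trans xj); exact: (jP j).1 (lexx j) _ Sk.
apply/algebraic_le => k kx; apply: ((jP k).2 _) => s Ss.
by apply: (le_trans (y := x)); [exact: kx|apply: xS; exists s].
Qed.

Lemma compacts_dual_infimums (S : set (compacts_dual L)) m :
  finite_set S -> infimums S m ->
  supremums [set val (k : @compacts _ L) | k in S] (val (m : @compacts _ L)).
Proof.
move=> Sfin Sm; apply/supremumsP => x; split=> [mx _ [k Sk <-]|Sx].
  move/infimumsP : Sm => /(_ m) [/(_ (lexx m) k Sk) km _].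
  by apply: (le_trans _ mx); exact: km.
apply: ((compacts_below_filter x).2 S m Sfin) Sm => k Sk.
by apply: Sx; exists k.
Qed.

End compacts.

(** * The equivalence between Brouwerian semilattices and Brouwerian frames *)

Section brwMS_hom.
Variables (A B : brwMS) (f : A -> B).
Hypothesis fhom : is_brwMS_hom f.

Let brwA := brwMSP A.
Let brwB := brwMSP B.

Lemma brwMS_hom_top : f (top_of brwA) = top_of brwB.
Proof.
have [fm _ _ _] := fhom.
have /(fm _ _ (finite_set0 _)) : infimums set0 (top_of brwA).
  by apply/infimums0P; exact: le_top_of.
rewrite image_set0 => /infimums0P ft; apply/le_anti.
by rewrite le_top_of ft.
Qed.

Lemma brwMS_hom_meet a b : f (meet_of brwA a b) = meet_of brwB (f a) (f b).
Proof.
have [fm _ _ _] := fhom.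
have := fm _ _ (finite_set2 a b) (infimums_meet_of brwA a b).
rewrite image_setU !image_set1 => fmP.
exact: infimums_unique fmP (infimums_meet_of brwB _ _).
Qed.

Lemma brwMS_hom_le a b : a <= b -> f a <= f b.
Proof.
move=> ab; have <- : meet_of brwA a b = a.
  by apply/le_anti; rewrite meet_of_le le_meet_of lexx ab.
by rewrite brwMS_hom_meet meet_of_le.
Qed.

Lemma brwMS_hom_imp a b : f (imp_of brwA a b) = imp_of brwB (f a) (f b).
Proof.
have [_ fi _ _] := fhom.
have {}fi := fi _ _ _ (@is_implication_imp_of _ _ brwA a b).
apply/le_anti/andP; split.
  by rewrite le_imp_of -(fi _ _ (infimums_meet_of brwB _ _)).
rewrite (fi _ _ (infimums_meet_of brwB _ _)).
by apply: (@meet_imp_of _ _ brwB (f a)); rewrite meet_of_le.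
Qed.

Lemma brwMS_hom_preimage_filter F : is_filter F -> is_filter (f @^-1` F).
Proof.
move=> Ff; apply/(is_filterP brwA); split=> [a b /= Fa ab|/=|a b /= Fa Fb].
- exact: filter_upset Ff _ _ Fa (brwMS_hom_le ab).
- by rewrite brwMS_hom_top; exact: filter_top.
- by rewrite brwMS_hom_meet; exact: filter_meet.
Qed.

Lemma brwMS_hom_image_filter F : is_filter F -> is_filter (upclosure (f @` F)).
Proof.
move=> Ff; apply/(is_filterP brwB); split.
- by move=> x y [z Fz zx] xy; exists z => //; exact: le_trans xy.
- exists (f (top_of brwA)); last exact: le_top_of.
  by exists (top_of brwA) => //; exact: filter_top.
- move=> x y [_ [a Fa <-] ax] [_ [b Fb <-] bx].
  exists (f (meet_of brwA a b)).
    by exists (meet_of brwA a b) => //; exact: filter_meet.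
  rewrite brwMS_hom_meet le_meet_of (le_trans _ ax) ?(le_trans _ bx) //;
  by rewrite meet_of_le.
Qed.

Lemma upclosure_image_sub F (G : set B) : is_filter G ->
  (upclosure (f @` F) `<=` G) <-> (F `<=` f @^-1` G).
Proof.
move=> Gf; split=> [FG a Fa|FG x [_ [a /FG Ga <-] ax]].
  by apply: FG; exists (f a); [exists a|].
exact: filter_upset Gf _ _ Ga ax.
Qed.

Definition filters_map (F : @filters _ A) : @filters _ B :=
  set_type_elt (brwMS_hom_image_filter (set_valP F)).

Lemma filters_le d (C : porderType d) (F G : @filters _ C) :
  (F <= G) <-> val F `<=` val G.
Proof. by change (val F <= val G <-> val F `<=` val G); rewrite subsetEset. Qed.

(** [filters_map] is left adjoint to taking preimages of filters. *)
Lemma filters_map_joins : preserves_joins filters_map.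
Proof.
move=> S s /supremumsP sP; apply/supremumsP => G.
pose G' : @filters _ A := set_type_elt (brwMS_hom_preimage_filter (set_valP G)).
have adj F : (filters_map F <= G) <-> (F <= G').
  rewrite !filters_le; exact: upclosure_image_sub (set_valP G).
rewrite adj sP; split=> [SG' _ [F SF <-]|SG F SF]; first exact/adj/SG'.
by apply/adj; apply: SG; exists F.
Qed.

(* A finite meet of images not contained in the image of the meet would be
   separated from it by a prime filter, whose preimage is prime. *)
Lemma filters_map_meets : preserves_finite_meets filters_map.
Proof.
move=> S m Sfin /(filter_repr_infimums brwA (filters_repr A)) mE.
apply/(filter_repr_infimums brwB (filters_repr B)) => /=; apply/seteqP; split.
  move=> x [_ [a ma <-] ax] _ [F SF <-]; exists (f a) => //; exists a => //.
  by move: ma; rewrite mE => /(_ F SF).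
move=> x xS; apply: contrapT => nx.
have [P [Pp mP nPx]] := prime_filter_separation brwB
  (brwMS_hom_image_filter (set_valP m)) nx.
have Pf := prime_filter_filter brwB Pp.
have [_ _ _ /(_ _ Pp) fPp] := fhom.
have nS F : S F -> exists a, val F a /\ ~ P (f a).
  move=> SF; apply: contrapT => nF; apply: nPx.
  have /(_ x) : upclosure (f @` val F) `<=` P; last first.
    by apply; exact: xS (filters_map F) (ex_intro2 _ _ F SF erefl).
  apply/upclosure_image_sub => // a Fa; apply: contrapT => nPa.
  by apply: nF; exists a.
have /choice [g gP] : forall F : @filters _ A, exists a, S F ->
  val F a /\ ~ P (f a).
  move=> F; have [SF|nSF] := pselect (S F); last by exists (top_of brwA).
  by have [a aP] := nS F SF; exists a.
(* The upper bound [c] lies outside the preimage of [P] and in every [F] of [S], hence in [m], whose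
   image is contained in [P]. *)
have [|c nPc Sc] := prime_filter_avoid brwA fPp (finite_image g Sfin).
- by move=> _ [F /gP [_ nPF] <-].
apply: nPc; apply: mP; exists (f c) => //; exists c => //.
rewrite mE => F SF; have [Fg _] := gP F SF.
by apply: filter_upset (set_valP F) _ _ Fg _; apply: Sc; exists F.
Qed.

Lemma filters_map_principal F a : val F = [set x | a <= x] ->
  val (filters_map F) = [set x | f a <= x].
Proof.
move=> FE; rewrite /= FE; apply/seteqP; split=> [x [_ [b ab <-] bx]|x ax].
  exact: le_trans (brwMS_hom_le ab) bx.
by exists (f a) => //; exists a => /=.
Qed.

Lemma filters_map_compacts :
  exists2 k : compacts_dual (@filters _ A) -> compacts_dual (@filters _ B),
    restricts_to_compacts filters_map k & preserves_implication k.
Proof.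
have [p [piso pE]] := filter_repr_compacts brwA (filters_repr A).
have [q [qiso qE]] := filter_repr_compacts brwB (filters_repr B).
have [p' [pK p'K _]] := order_iso_bij piso.
exists (fun x => q (f (p' x))).
  move=> x; apply: val_inj; rewrite qE; symmetry; apply: filters_map_principal.
  by rewrite -pE p'K.
move=> x y z; rewrite -[x]p'K -[y]p'K -[z]p'K !pK.
rewrite (order_iso_implication piso) (order_iso_implication qiso).
by case: fhom => _ fi _ _; exact: fi.
Qed.

Lemma filters_map_hom :
  @is_brwFrm_hom (BrwFrmObj (F_wf_holds A)) (BrwFrmObj (F_wf_holds B))
    filters_map.
Proof.
split; last exact: filters_map_compacts.
by split; [exact: filters_map_joins|exact: filters_map_meets].
Qed.

End brwMS_hom.

Definition F_fmap (A B : brwMS) (h : brwMS_hom A B) :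
    brwFrm_hom (BrwFrmObj (F_wf_holds A)) (BrwFrmObj (F_wf_holds B)) :=
  exist _ _ (filters_map_hom (svalP h)).

Lemma F_functor_ex :
  exists F : functor BrwMS_P BrwFrm (F_obj F_wf_holds), F_spec F.
Proof.
have F1 (A : BrwMS_P) : F_fmap (idc A) = @idc BrwFrm (F_obj F_wf_holds A).
  apply: sval_inj; apply/funext => x; apply: val_inj => /=.
  rewrite image_id; apply/seteqP; split=> [a [b xb ba]|a xa]; last by exists a.
  exact: filter_upset (set_valP x) _ _ xb ba.
have FM (A B C : BrwMS_P) (f : hom B C) (g : hom A B) :
    F_fmap (comp f g) = @comp BrwFrm (F_obj F_wf_holds A) (F_obj F_wf_holds B)
      (F_obj F_wf_holds C) (F_fmap f) (F_fmap g).
  apply: sval_inj; apply/funext => x; apply: val_inj => /=.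
  apply/seteqP; split=> [c [_ [a xa <-] fgc]|c [_ [b [_ [a xa <-] gab] <-]
    fbc]].
    exists (sval f (sval g a)) => //; exists (sval g a) => //.
    by exists (sval g a) => //; exists a.
  exists (sval f (sval g a)); first by exists a.
  exact: le_trans (brwMS_hom_le (svalP f) gab) fbc.
by exists (@Functor BrwMS_P BrwFrm (F_obj F_wf_holds) F_fmap F1 FM).
Qed.

Section brwFrm_hom.
Variables (L M : brwFrm) (alpha : L -> M).
Hypothesis ahom : is_brwFrm_hom alpha.

Let brwL := brwFrmP L.
Let brwM := brwFrmP M.

Lemma brwFrm_hom_le x y : x <= y -> alpha x <= alpha y.
Proof.
move=> xy; have [[aj _] _] := ahom.
have : supremums [set x; y] y.
  by apply/supremumsP => z; split=> [yz _ [->|->] //|];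
    [exact: le_trans yz|apply; right].
by move=> /aj /supremumsP /(_ (alpha y)) [/(_ (lexx _)) + _]; apply;
  exists x => //; left.
Qed.

Lemma brwFrm_hom_compact_le x (y : M) :
  (forall k : compacts_dual L, compacts_below x k ->
     alpha (val (k : @compacts _ L)) <= y) -> alpha x <= y.
Proof.
move=> ky; have [[aj _] _] := ahom.
have : supremums [set val (k : @compacts _ L) | k in compacts_below x] x.
  apply/supremumsP => z; split=> [xz _ [k kx <-]|zP]; first exact: le_trans xz.
  by apply/(algebraic_le brwL) => k kx; apply: zP; exists k.
by move=> /aj /supremumsP /(_ y) [_]; apply => _ [_ [k kx <-] <-]; exact: ky.
Qed.

Variable k : compacts_dual L -> compacts_dual M.
Hypothesis alpha_k : restricts_to_compacts alpha k.

Lemma restriction_image (S : set (compacts_dual L)) :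
  [set val (x : @compacts _ M) | x in [set k x | x in S]] =
  [set alpha x | x in [set val (x : @compacts _ L) | x in S]].
Proof.
rewrite !image_comp; apply: eq_imagel => x Sx.
exact: alpha_k.
Qed.

(** Finite meets of the dual of the compact elements are joins of [L], so preservation of joins by
    [alpha] is what counts here. *)
Lemma restriction_meets : preserves_finite_meets k.
Proof.
move=> S m Sfin Sm; have [[aj _] _] := ahom.
have /aj := compacts_dual_infimums brwL Sfin Sm.
rewrite -restriction_image -alpha_k => /supremumsP mP; apply/infimumsP => x.
change (val (k m : @compacts _ M) <= val (x : @compacts _ M) <->
  (forall s, [set k x | x in S] s -> val (s : @compacts _ M) <= val (x :
    @compacts _ M))).
rewrite mP; split=> [xS s Ss|xS _ [s Ss <-]]; last exact: xS.
by apply: xS; exists s.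
Qed.

(** Joins of the dual, where they exist, are meets of [L], so here preservation of finite meets
    counts. *)
Lemma restriction_joins : preserves_finite_joins k.
Proof.
move=> S j Sfin Sj; have [[_ am] _] := ahom.
have /am := compacts_dual_supremums brwL Sj.
move=> /(_ (finite_image _ Sfin)).
rewrite -restriction_image -alpha_k => /infimumsP jP; apply/supremumsP => x.
change (val (x : @compacts _ M) <= val (k j : @compacts _ M) <->
  (forall s, [set k x | x in S] s -> val (x : @compacts _ M) <= val (s :
    @compacts _ M))).
rewrite jP; split=> [xS s Ss|xS _ [s Ss <-]]; last exact: xS.
by apply: xS; exists s.
Qed.

Lemma restriction_prime P : prime_filter P -> prime_filter (k @^-1` P).
Proof.
have [_ _ brwK] := brwL; have [_ _ brwK'] := brwM.
move=> /(prime_filterP brwK') [Pf Pn Pd].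
have [p pE] := filter_repr_surj (compacts_below_repr brwM) Pf.
have [[aj am] _] := ahom.
have Pk x : P (k x) <-> alpha (val (x : @compacts _ L)) <= p.
  by rewrite -pE /compacts_below /= alpha_k.
apply/(prime_filterP brwK); split.
- apply/(is_filterP brwK); split=> [x y /= /Pk xp xy|/=|x y /= Px Py].
  + by apply/Pk; apply: le_trans xp; apply: brwFrm_hom_le; exact: xy.
  + have : infimums [set k x | x in set0] (k (top_of brwK)).
      apply: restriction_meets; first exact: finite_set0.
      by apply/infimums0P; exact: le_top_of.
    by apply: Pf.2; rewrite image_set0 //; exact: finite_set0.
  + have := restriction_meets (finite_set2 x y) (infimums_meet_of brwK x y).
    apply: Pf.2; first exact/finite_image/finite_set2.
    by move=> _ [_ [->|->] <-].
- move=> kPT; apply: Pn; rewrite -pE; apply/seteqP; split=> // y _.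
  have [t tP] := frame_supremums brwL setT.
  have tmax x : x <= t by move/supremumsP : tP => /(_ t) [/(_ (lexx t)) + _];
    apply.
  have atp : alpha t <= p.
    apply: brwFrm_hom_compact_le => x _; apply/Pk.
    by change ((k @^-1` P) x); rewrite kPT.
  apply: le_trans atp; have /(am _ _ (finite_set0 _)) : infimums set0 t.
    by apply/infimums0P.
  by rewrite image_set0 => /infimums0P; apply.
- move=> x y /= nPx nPy; have [z [nPz xz yz]] := Pd _ _ nPx nPy.
  (* The meet [i] of [x] and [y] in [L] need not be compact. If every compact element below it had
     its image in [P], then [alpha i <= p] by algebraicity, and [z], being below the images of [x]
     and [y], would lie in [P]. *)
  have [i iP] := filter_repr_surj (compacts_below_repr brwL)
    (filter_setI brwK (compacts_below_filter brwL (val (x : @compacts _ L)))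
       (compacts_below_filter brwL (val (y : @compacts _ L)))).
  have /(filter_repr_infimums2 brwK (compacts_below_repr brwL)) iinf := iP.
  apply: contrapT => nc; apply: nPz.
  have : alpha i <= p.
    apply: brwFrm_hom_compact_le => c; rewrite iP => -[cx cy]; apply/Pk.
    by apply: contrapT => nPc; apply: nc; exists c.
  rewrite -pE; apply: le_trans.
  have := am _ _ (finite_set2 _ _) iinf.
  rewrite image_setU !image_set1 => /infimums2P ->.
  by rewrite -!alpha_k; apply/andP; split; [exact: xz|exact: yz].
Qed.

End brwFrm_hom.

Lemma restriction_ex (L M : brwFrm) (alpha : brwFrm_hom L M) :
  exists k : brwMS_hom (K_obj L) (K_obj M),
    restricts_to_compacts (sval alpha) (sval k).
Proof.
case: alpha => alpha ahom /=; have [_ [k kP ki]] := ahom.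
suff kh : @is_brwMS_hom (K_obj L) (K_obj M) k by exists (exist _ k kh).
split=> //; [exact: restriction_meets kP|exact: restriction_joins kP|].
exact: restriction_prime kP.
Qed.

Lemma K_functor_ex : exists K : functor BrwFrm BrwMS_P K_obj, K_spec K.
Proof.
(* A morphism of frames comes only with the existence of a restriction; choosing one is harmless,
   since its values are determined by [alpha]. *)
pose K (L M : brwFrm) (alpha : brwFrm_hom L M) :=
  sval (cid (restriction_ex alpha)).
have KP L M alpha : restricts_to_compacts (sval alpha) (sval (K L M alpha)).
  by rewrite /K; case: cid.
have K1 (L : BrwFrm) : K L L (idc L) = @idc BrwMS_P (K_obj L).
  by apply: sval_inj; apply/funext => x; apply: val_inj; rewrite KP.
have KM (L M N : BrwFrm) (f : hom M N) (g : hom L M) :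
    K L N (comp f g) = @comp BrwMS_P (K_obj L) (K_obj M) (K_obj N) (K M N f) (K
      L M g).
  by apply: sval_inj; apply/funext => x; apply: val_inj; rewrite /= !KP.
by exists (@Functor BrwFrm BrwMS_P K_obj K K1 KM) => L M alpha; exact: KP.
Qed.

(** * Order isomorphisms are isomorphisms *)

Lemma order_iso_prime_filter d d' (A : porderType d) (B : porderType d')
    (f : A -> B) P : is_brouwerian A -> is_brouwerian B -> order_iso f ->
  prime_filter P -> prime_filter (f @^-1` P).
Proof.
move=> brwA brwB fiso /(prime_filterP brwB) [Pf Pn Pd].
have [g [fK gK giso]] := order_iso_bij fiso.
apply/(prime_filterP brwA); split.
- split=> [x y /= Px xy|S m Sfin SP Sm]; first by apply: (Pf.1 _ _ Px);
    rewrite fiso.1.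
  apply: (Pf.2 (f @` S)); [exact: finite_image|by move=> _ [x /SP Px <-]|].
  by rewrite order_iso_infimums.
- move=> PT; apply: Pn; apply/seteqP; split=> // y _.
  by rewrite -[y]gK; change ((f @^-1` P) (g y)); rewrite PT.
- move=> x y nPx nPy; have [z [nPz xz yz]] := Pd _ _ nPx nPy.
  exists (g z); split; [by rewrite /= gK|by rewrite -fiso.1 gK|by rewrite
    -fiso.1 gK].
Qed.

Lemma order_iso_brwMS_hom (A B : brwMS) (f : A -> B) :
  order_iso f -> is_brwMS_hom f.
Proof.
move=> fiso; split.
- by move=> S m _; rewrite order_iso_infimums.
- by move=> a b c; rewrite order_iso_implication.
- by move=> S m _; rewrite order_iso_supremums.
- by move=> P; apply: order_iso_prime_filter fiso;
    [exact: brwMSP|exact: brwMSP].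
Qed.

Lemma order_iso_brwFrm_hom (L M : brwFrm) (f : L -> M) :
  order_iso f -> is_brwFrm_hom f.
Proof.
move=> fiso; split.
  split; first by move=> S m; rewrite order_iso_supremums.
  by move=> S m _; rewrite order_iso_infimums.
have kc (k : compacts_dual L) : compact_element (f (val (k : @compacts _ L))).
  by apply/order_iso_compact => //; exact: set_valP.
pose k (x : compacts_dual L) : compacts_dual M := set_type_elt (kc x).
exists k => //.
have kiso : order_iso k.
  split=> [x y|y]; first exact: fiso.1.
  have [x xE] := fiso.2 (val (y : @compacts _ M)).
  have xc : compact_element x.
    by apply/(order_iso_compact fiso); rewrite xE; exact: set_valP.
  by exists (set_type_elt xc); apply: val_inj.
by move=> a b c; rewrite order_iso_implication.
Qed.

Lemma order_iso_brwMS (A B : brwMS) (f : A -> B) : order_iso f ->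
  exists g : @hom BrwMS_P A B, sval g = f /\ isomorphism g.
Proof.
move=> fiso; have [g [fK gK giso]] := order_iso_bij fiso.
exists (exist _ f (order_iso_brwMS_hom fiso)); split=> //.
exists (exist _ g (order_iso_brwMS_hom giso)).
by split; apply: sval_inj; apply/funext.
Qed.

Lemma order_iso_brwFrm (L M : brwFrm) (f : L -> M) : order_iso f ->
  exists g : @hom BrwFrm L M, sval g = f /\ isomorphism g.
Proof.
move=> fiso; have [g [fK gK giso]] := order_iso_bij fiso.
exists (exist _ f (order_iso_brwFrm_hom fiso)); split=> //.
exists (exist _ g (order_iso_brwFrm_hom giso)).
by split; apply: sval_inj; apply/funext.
Qed.

Lemma filter_repr_order_iso d d' d'' (A : porderType d) (L : porderType d')
    (M : porderType d'') (e : L -> set A) (e' : M -> set A) :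
  filter_repr e -> filter_repr e' ->
  exists f : L -> M, order_iso f /\ forall x, e' (f x) = e x.
Proof.
move=> er er'.
have [f fE] := choice (fun x => filter_repr_surj er' (filter_repr_filter er x)).
exists f; split=> //; split=> [x y|y].
  by apply/idP/idP; rewrite (filter_repr_le er) (filter_repr_le er') !fE.
have [x xE] := filter_repr_surj er (filter_repr_filter er' y).
by exists x; apply: (filter_repr_inj er'); rewrite fE.
Qed.

Section KF_FK.
Variables (F : functor BrwMS_P BrwFrm (F_obj F_wf_holds)).
Variables (K : functor BrwFrm BrwMS_P K_obj).
Hypotheses (FP : F_spec F) (KP : K_spec K).

Lemma KF_nat_iso : nat_iso (K \oF F) (id_functor BrwMS_P).
Proof.
(* The explicit direction is the one from the identity, sending [a] to its principal filter. *)
apply: nat_iso_sym.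
pose p (A : brwMS) := cid (filter_repr_compacts (brwMSP A) (filters_repr A)).
have pE (A : brwMS) a : val (val (sval (p A) a : @compacts _ (@filters _ A))) =
  [set x | a <= x].
  by rewrite /p; case: cid => ? []/= _ ->.
have piso (A : brwMS) : order_iso (sval (p A)) by rewrite /p; case: cid => ? [].
pose eta (A : brwMS) := cid (@order_iso_brwMS A (K_obj (F_obj F_wf_holds A)) _
  (piso A)).
have etaE (A : brwMS) : sval (sval (eta A)) = sval (p A) by rewrite /eta;
  case: cid => ? [].
exists (fun A => sval (eta A)); split=> [A B h|A];
  last by case: (eta A) => ? [].
apply: sval_inj; apply/funext => a; apply: val_inj; apply: val_inj.
change (val (val (sval (fmap K (fmap F h)) (sval (sval (eta A)) a) : @compacts _
  (@filters _ B)))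
  = val (val (sval (sval (eta B)) (sval h a) : @compacts _ (@filters _ B)))).
rewrite !etaE pE; apply: etrans (congr1 val (KP (fmap F h) _)) _.
apply: etrans (FP h _) _; exact (filters_map_principal (svalP h) (pE A a)).
Qed.

Lemma FK_nat_iso : nat_iso (F \oF K) (id_functor BrwFrm).
Proof.
apply: nat_iso_sym.
pose p (L : brwFrm) := cid (filter_repr_order_iso (compacts_below_repr (brwFrmP
  L))
  (filters_repr (compacts_dual L))).
have pE (L : brwFrm) x : val (sval (p L) x) = compacts_below x.
  by rewrite /p; case: cid => ? []/= _ ->.
have piso (L : brwFrm) : order_iso (sval (p L)) by rewrite /p;
  case: cid => ? [].
pose eta (L : brwFrm) := cid (@order_iso_brwFrm L (F_obj F_wf_holds (K_obj L)) _
  (piso L)).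
have etaE (L : brwFrm) : sval (sval (eta L)) = sval (p L) by rewrite /eta;
  case: cid => ? [].
exists (fun A => sval (eta A)); split=> [L M h|L];
  last by case: (eta L) => ? [].
apply: sval_inj; apply/funext => x; apply: val_inj.
change (val (sval (fmap F (fmap K h)) (sval (sval (eta L)) x) : @filters _
  (compacts_dual M))
  = val (sval (sval (eta M)) (sval h x) : @filters _ (compacts_dual M))).
rewrite !etaE pE; apply: etrans (FP (fmap K h) _) _; rewrite pE.
have KhP := KP h; have hhom := svalP h.
apply/seteqP; split=> [c [_ [b bx <-] bc]|c cx].
  apply: (le_trans (y := val (sval (fmap K h) b : @compacts _ M)));
    first exact: bc.
  by rewrite KhP; apply: brwFrm_hom_le => //; exact: bx.
(* The filter generated by the images is named [F'] and realised as the compact elements below some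
   [y]; the inequality [h x <= y] can then be tested on the compact elements below [x]. *)
have [F' F'E] : exists F' : set (compacts_dual M),
    F' = upclosure (sval (fmap K h) @` compacts_below x) by eexists.
have F'f : is_filter F'.
  rewrite F'E; apply: (@brwMS_hom_image_filter (K_obj L) (K_obj M)).
    exact: svalP.
  exact/compacts_below_filter/brwFrmP.
rewrite -F'E; have [y yE] := filter_repr_surj (compacts_below_repr (brwFrmP M))
  F'f.
rewrite -yE; apply: (le_trans (y := sval h x)); first exact: cx.
apply: brwFrm_hom_compact_le => // k kx; rewrite -KhP.
suff : compacts_below y (sval (fmap K h) k) by [].
rewrite yE F'E; exists (sval (fmap K h) k) => //; by exists k.
Qed.

End KF_FK.

(** * Representing spaces by optimal filters *)

(** Compactness is given by cluster points: if no finite subfamily covered [C], the sets [C] minus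
    finite unions would generate a proper filter, whose cluster point lies in [C] but in no
    [f i]. *)
Lemma compact_subcover (X : topologicalType) (I : Type) (C : set X) (D : set I)
    (f : I -> set X) :
  compact [set: X] -> closed C -> (forall i, D i -> open (f i)) ->
  C `<=` \bigcup_(i in D) f i ->
  exists S, [/\ finite_set S, S `<=` D & C `<=` \bigcup_(i in S) f i].
Proof.
move=> Xc Cc fo CD; apply: contrapT => nS.
pose Fi : set_system X := [set W | exists S,
  [/\ finite_set S, S `<=` D & C `\` \bigcup_(i in S) f i `<=` W]].
have FiF : ProperFilter Fi.
  split.
    move=> [S [Sfin SD S0]]; apply: nS; exists S; split=> // x Cx.
    by apply: contrapT => nx; apply: (S0 x).
  split.
  - by exists set0; split=> //; exact: sub0set.
  - move=> V W [S [Sfin SD SV]] [T [Tfin TD TW]]; exists (S `|` T); split.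
    + by rewrite finite_setU.
    + by move=> i [/SD|/TD].
    + move=> x [Cx nx]; split.
        by apply: SV; split=> // -[i Si xi]; apply: nx; exists i => //; left.
      by apply: TW; split=> // -[i Si xi]; apply: nx; exists i => //; right.
  - by move=> V W VW [S [Sfin SD SV]]; exists S; split=> //;
      apply: subset_trans VW.
have FiC : Fi C by exists set0; split=> // x [].
have [p [_ pcl]] := Xc Fi FiF filterT.
have Cp : C p by apply: Cc => B Bp; exact: pcl.
have [i Di pi] := CD p Cp.
have [x [[Cx nxi] xi]] : (C `\` f i) `&` f i !=set0.
  apply: pcl; last by apply: open_nbhs_nbhs; split=> //; exact: fo.
  exists [set i]; split=> //; first by move=> _ ->.
  by move=> x [Cx nx]; split=> // xi; apply: nx; exists i.
exact: nxi.
Qed.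

(** A finite intersection of subbasic sets around [x] amounts to finitely many required and
    forbidden elements; each goes to [S] or to [T] according to whether [e x] contains it. *)
Lemma subbase_refine (X A : Type) (e : X -> set A) (D : set (set X)) (x : X) :
  finite_set D ->
  (forall V, D V -> exists a, V = [set y | e y a] \/ V = ~` [set y | e y a]) ->
  (forall V, D V -> V x) ->
  exists S T, [/\ finite_set S, finite_set T, S `<=` e x, T `<=` ~` e x &
    forall y, S `<=` e y -> T `<=` ~` e y -> forall V, D V -> V y].
Proof.
move=> Dfin De Dx.
(* [A] may be empty, so a default value for [g] is at hand only when [D] has a member. *)
have [D0|/set0P [V0 DV0]] := eqVneq D set0.
  by exists set0, set0; split=> //; rewrite D0.
have [a0 _] := De _ DV0.
have /choice [g gP] : forall V, exists a,
    D V -> V = [set y | e y a] \/ V = ~` [set y | e y a].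
  move=> V; have [DV|nDV] := pselect (D V); last by exists a0.
  by have [a aP] := De V DV; exists a.
have gfin := finite_image g Dfin.
exists (g @` D `&` e x), (g @` D `&` ~` e x); split.
- by apply: sub_finite_set gfin => a [].
- by apply: sub_finite_set gfin => a [].
- by move=> a [].
- by move=> a [].
move=> y Sy Ty V DV; have gDV : (g @` D) (g V) by exists V.
have Vx := Dx V DV; have [VE|VE] := gP V DV; rewrite VE.
  by apply: Sy; split=> //; rewrite VE in Vx.
by apply: Ty; split=> //; rewrite VE in Vx.
Qed.

(** The counterpart of [filter_repr] for spaces: [X] looks like the space of optimal filters of [A].
    The topology enters only through the admissible clopen upsets, which is all of it that
    [is_pges_hom] refers to. *)
Definition space_repr d d' (X : POrderedTopological.type d) (X0 : set X)
    (A : porderType d') (e : X -> set A) : Prop :=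
  [/\ forall x y, (x <= y) <-> e x `<=` e y,
      forall F, optimal_or_full F <-> exists x, e x = F,
      forall x, X0 x <-> prime_filter (e x) &
      forall U, adm_clopen_upsets X0 U <-> exists a, U = [set x | e x a]].

Section spectral_space.
Context {d d' : Order.disp_t} {X : POrderedTopological.type d} {A : porderType
  d'}.
Variables (X0 : set X) (m : X) (e : X -> set A).
Hypotheses (brwA : is_brouwerian A).
Hypothesis e_le : forall x y, (x <= y) <-> e x `<=` e y.
Hypothesis e_range : forall F, optimal_or_full F <-> exists x, e x = F.
Hypothesis e_core : forall x, X0 x <-> prime_filter (e x).
Hypothesis e_max : e m = setT.
Hypothesis e_open : forall a, open [set x | e x a] /\ open [set x | ~ e x a].
Hypothesis e_base : forall x U, open U -> U x -> exists S T,
  [/\ finite_set S, finite_set T, S `<=` e x, T `<=` ~` e x &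
      forall y, S `<=` e y -> T `<=` ~` e y -> U y].

Let phi (a : A) : set X := [set x | e x a].

Let e_inj : injective e.
Proof.
by move=> x y exy; apply/le_anti/andP; split; apply/e_le; rewrite exy.
Qed.

Let e_filter x : is_filter (e x).
Proof. by apply: optimal_or_full_filter => //; apply/e_range; exists x. Qed.

Let e_prime P : prime_filter P -> exists2 x, X0 x & e x = P.
Proof.
move=> Pp; have /e_range [x xP] : optimal_or_full P.
  by left; exact: (prime_filter_optimal brwA).
by exists x => //; apply/e_core; rewrite xP.
Qed.

Let e_optimal x : x <> m -> optimal_filter (e x).
Proof.
move=> xm; have /e_range [//|ex] : exists y, e y = e x by exists x.
by case: xm; apply: e_inj; rewrite ex e_max.
Qed.

Let phi_sub a b : phi a `<=` phi b <-> a <= b.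
Proof.
split=> [ab|ab x]; last by move=> xa; exact: filter_upset (e_filter x) _ _ xa
  ab.
apply/negPn/negP => nab; have [P [Pp Pa nPb]] := prime_filter_le brwA nab.
have [x _ xP] := e_prime Pp; apply: nPb; rewrite -xP; apply: ab.
by rewrite /phi /= xP.
Qed.

Let core_avoiding x U : adm_clopen_upsets X0 U -> ~ U x ->
  exists2 y, X0 y & x <= y /\ ~ U y.
Proof. by move=> [Ua _ _] nUx; have [y [Xy nUy] xy] := Ua x nUx; exists y. Qed.

Let phi_clopen a : clopen (phi a).
Proof.
split; first by case: (e_open a).
by rewrite -openC; case: (e_open a).
Qed.

Let phi_adm a : adm_clopen_upsets X0 (phi a).
Proof.
split; [|exact: phi_clopen|].
  move=> x nxa; have [P [Pp xP nPa]] := prime_filter_separation brwA (e_filter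
    x) nxa.
  have [y Xy yP] := e_prime Pp; exists y; last by apply/e_le; rewrite yP.
  by split=> //; rewrite /phi /= yP.
by move=> x y xa /e_le; apply.
Qed.

Let prime_avoid x S : X0 x -> finite_set S -> (forall a, S a -> ~ e x a) ->
  exists2 a, ~ e x a & forall s, S s -> s <= a.
Proof. by move=> /e_core xp Sfin Sx; exact: prime_filter_avoid Sfin Sx. Qed.

(** An ultrafilter [U] converges to the point given by [F], the set of all [a] with [phi a] in [U].
    The issue is that [F] be optimal or full: a violation involves finitely many elements, so it
    would occur at a single point [y]. *)
Let space_compact : compact [set: X].
Proof.
rewrite compact_ultra => U Uu _.
pose F := [set a | U (phi a)].
have UF : ProperFilter U by exact: ultra_proper.
have Ff : is_filter F.
  apply/(is_filterP brwA); split=> [a b Fa ab|/=|a b Fa Fb].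
  - by apply: (@filterS _ U _ (phi a) (phi b)) => //; exact/phi_sub.
  - by apply: (@filterE _ U _ (phi _)) => x; exact: filter_top.
  - apply: (@filterS _ U _ (phi a `&` phi b) (phi _)); last exact: filterI.
    by move=> x [xa xb]; exact: filter_meet.
have /e_range [x xF] : optimal_or_full F.
  have [->|nF] := pselect (F = setT); [by right|left].
  split=> // S Sfin SF t tS Ft.
  have US : U [set y | S `<=` ~` e y].
    move: Sfin SF {tS} => /finite_seqP [l ->].
    elim: l => [_|a l IHl lF]; first by apply: filterE => y.
    have Ul := IHl (fun b bl => lF b (mem_behead (s := a :: l) bl)).
    have Ua : U (~` phi a).
      by have [Ua|//] := in_ultra_setVsetC (phi a) Uu;
        case: (lF a (mem_head a l)).
    apply: filterS (filterI Ul Ua) => y [yl nya] b;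
      rewrite /= inE => /predU1P [->//|].
    exact: yl.
  (* [y] contains [t] and avoids [S]. If [e y] is optimal, this contradicts its Frink condition; if
     it is full, [S] is empty, so [t] is the least element and [F] is full. *)
  have [y [yS yt]] := filter_ex (filterI US Ft).
  have /e_range [[yf yF]|yT] : exists z, e z = e y by exists y.
    exact: (yF S Sfin yS t tS yt).
  apply: nF; apply/seteqP; split=> // a _; apply: (filter_upset Ff Ft).
  by apply: tS => s Ss; case: (yS s Ss); rewrite yT.
exists x; split=> //= B; rewrite nbhsE => -[V [Vo Vx] VB].
have [S [T [Sfin Tfin Sx Tx ST]]] := e_base Vo Vx.
have US : U [set y | S `<=` e y].
  move: Sfin Sx {ST} => /finite_seqP [l ->].
  elim: l => [_|a l IHl lx]; first by apply: filterE => y.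
  have Ul := IHl (fun b bl => lx b (mem_behead (s := a :: l) bl)).
  have Ua : U (phi a) by have := lx a (mem_head a l); rewrite xF.
  apply: filterS (filterI Ul Ua) => y [yl nya] b;
    rewrite /= inE => /predU1P [->//|].
  exact: yl.
have UT : U [set y | T `<=` ~` e y].
  move: Tfin Tx {ST} => /finite_seqP [l ->].
  elim: l => [_|a l IHl lF]; first by apply: filterE => y.
  have Ul := IHl (fun b bl => lF b (mem_behead (s := a :: l) bl)).
  have Ua : U (~` phi a).
    by have [Ua|//] := in_ultra_setVsetC (phi a) Uu;
      case: (lF a (mem_head a l)); rewrite xF.
  apply: filterS (filterI Ul Ua) => y [yl nya] b;
    rewrite /= inE => /predU1P [->//|].
  exact: yl.
apply: filterS (filterI US UT) => y [Sy Ty]; apply: VB; exact: ST.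
Qed.

(** Compactness is used twice. A point outside [U] is below a core point [p] outside [U]; finitely
    many [phi b] with [b] outside [e p] cover [U], and primeness of [e p] merges them into one
    [phi a]. Finitely many such [phi a] already cut out [U], and the meet of their indices
    represents it. *)
Let adm_phi U : adm_clopen_upsets X0 U <-> exists a, U = phi a.
Proof.
split=> [UU|[a ->]]; last exact: phi_adm.
have [_ [Uo Uc] Uup] := UU.
have sepU x : ~ U x -> exists a, U `<=` phi a /\ ~ e x a.
  move=> nUx; have [p Xp [xp nUp]] := core_avoiding UU nUx.
  have [| |S [Sfin Sp US]] := @compact_subcover X A U (~` e p) phi space_compact
    Uc.
  - by move=> a _; case: (phi_clopen a).
  - move=> y Uy; apply: contrapT => ny; apply: nUp; apply: (Uup y) => //.
    by apply/e_le => a ya; apply: contrapT => na; apply: ny; exists a.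
  have [a na Sa] := prime_avoid Xp Sfin Sp; exists a; split.
    by move=> y /US [b Sb]; exact: (phi_sub b a).2 (Sa b Sb) y.
  by move=> xa; apply: na; move/e_le : xp; apply.
have [| |S [Sfin SU US]] := @compact_subcover X A (~` U) [set a | U `<=` phi a]
    (fun a => ~` phi a) space_compact (open_closedC Uo).
- by move=> a _; apply: closed_openC; case: (phi_clopen a).
- by move=> x /sepU [a [Ua na]]; exists a.
have [t St] := brwA.1 S Sfin; exists t; apply/seteqP; split=> x.
  move=> Ux; apply: ((e_filter x).2 S t Sfin _ St) => a Sa; exact: SU.
move=> xt; apply: contrapT => /US [a Sa]; apply.
apply: (filter_upset (e_filter x) xt); move/infimumsP : St => /(_ t) [+ _].
by move=> /(_ (lexx t)); apply.
Qed.

Lemma spectral_space_repr : space_repr X0 e.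
Proof. by split. Qed.

Let max_top x : x <= m.
Proof. by apply/e_le; rewrite e_max. Qed.

Let avoidP x a : adm_avoiding X0 x (phi a) <-> ~ e x a.
Proof. by split=> [[]|nxa] //; split=> //; exact: phi_adm. Qed.

(** Through [phi] the sets avoiding [x] are the elements outside [e x], so this is [prime_filterP]
    again. *)
Let core_avoidP x :
  X0 x <-> adm_avoiding X0 x !=set0 /\ directed (adm_avoiding X0 x).
Proof.
rewrite e_core prime_filterP //; split=> [[xf xn xd]|[[U [/adm_phi [u ->] nxu]]
  xd]].
  split.
    have /existsNP [a /(avoidP x a) xa] : ~ forall a, e x a.
      by move=> xT; apply: xn; apply/seteqP; split.
    by exists (phi a).
  move=> U V [/adm_phi [a ->] na] [/adm_phi [b ->] nb].
  have [c [nc ac bc]] := xd _ _ na nb; exists (phi c).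
  by split; [exact/avoidP|rewrite subsetEset; exact/phi_sub|rewrite subsetEset;
    exact/phi_sub].
split=> [//|xT|a b na nb]; first by apply: nxu; rewrite /phi /= xT.
have [_ [[/adm_phi [c ->] nc]]] :=
  xd _ _ ((avoidP x a).2 na) ((avoidP x b).2 nb).
by rewrite !subsetEset !phi_sub; exists c.
Qed.

(** In a basic neighbourhood the required elements [S] are replaced by their meet, and
    [prime_filters_dense] supplies a core point. *)
Let dense : [set~ m] `<=` closure X0.
Proof.
move=> x xm B; rewrite nbhsE => -[V [Vo Vx] VB].
have [S [T [Sfin Tfin Sx Tx ST]]] := e_base Vo Vx.
have [t St] := brwA.1 S Sfin.
have xt : e x t by exact: (e_filter x).2 Sx St.
have [P [Pp Pt TP]] := prime_filters_dense brwA (e_optimal xm) xt Tfin Tx.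
have [y Xy yP] := e_prime Pp; exists y; split=> //; apply/VB/ST; rewrite yP //.
move=> s Ss; apply: (filter_upset (prime_filter_filter brwA Pp) Pt).
by move/infimumsP : St => /(_ t) [/(_ (lexx t)) + _]; apply.
Qed.

Let cofinal x : x <> m -> exists2 y, X0 y & x <= y.
Proof.
move=> xm; have /existsNP [a nxa] : ~ forall a, e x a.
  by move=> xT; apply: xm; apply: e_inj; rewrite e_max; apply/seteqP; split.
have [P [Pp xP _]] := prime_filter_separation brwA (e_filter x) nxa.
by have [y Xy yP] := e_prime Pp; exists y => //; apply/e_le; rewrite yP.
Qed.

(** This identity yields the Esakia condition. If [a -> b] is not in [e x], then [b] is not in the
    filter generated by [e x] and [a]; a prime filter extending the latter without [b] is a point
    above [x]. *)
Let down_phi a b : downclosure (phi a `\` phi b) = ~` phi (imp_of brwA a b).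
Proof.
apply/seteqP; split=> x; rewrite /phi /=.
  move=> [y [ya nyb] /e_le xy] xab; apply: nyb.
  apply: (filter_upset (e_filter y) (filter_meet brwA (e_filter y) ya (xy _
    xab))).
  by rewrite -le_imp_of.
move=> nxab; have nb : ~ filter_add brwA (e x) a b.
  by move=> /(filter_addP brwA _ _ (e_filter x)).
have [P [Pp xP nPb]] :=
  prime_filter_separation brwA (filter_filter_add brwA a (e_filter x)) nb.
have [y Xy yP] := e_prime Pp; exists y.
  by split; rewrite /= yP //; apply: xP; exact: filter_add_mem.
by apply/e_le; rewrite yP; apply: subset_trans xP; exact: sub_filter_add.
Qed.

Lemma spectral_space_is_pges : is_pges X0 m.
Proof.
split; last first.
  move=> U V /adm_phi [a ->] /adm_phi [b ->]; rewrite down_phi.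
  by have [ao ac] := phi_clopen (imp_of brwA a b); split;
    [exact: closed_openC|exact: open_closedC].
split.
- split; last exact: max_top.
  split=> // x y /negP nxy.
  have [a xa nya] : exists2 a, e x a & ~ e y a.
    apply: contrapT => nE; apply: nxy; apply/e_le => a xa.
    by apply: contrapT => nya; apply: nE; exists a.
  by exists (phi a); split=> // u v /= ua /e_le; apply.
- split; [|exact: dense|exact: cofinal].
  move=> x /e_core /(prime_filterP brwA) [_ xn _] /= xm.
  by apply: xn; rewrite xm e_max.
- exact: core_avoidP.
- move=> x y; split=> [xy U [_ _ Uup] Ux|H]; first exact: Uup xy.
  by apply/e_le => a xa; exact: (H _ (phi_adm a)).
Qed.

End spectral_space.

(** * The spaces of optimal filters and of pseudoprime elements *)

Section optimal_space.
Context {d : Order.disp_t} (A : porderType d).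

Lemma optimal_space_open (U : set (optimal_space A)) :
  (exists a, U = phi a \/ U = ~` phi a) -> open U.
Proof.
move=> Usub; exists [set U]; last by rewrite bigcup_set1.
by move=> _ ->; apply: (@finI_from1 _ _ _ id).
Qed.

Lemma optimal_space_base (x : optimal_space A) U : open U -> U x -> exists S T,
  [/\ finite_set S, finite_set T, S `<=` val x, T `<=` ~` val x &
      forall y : optimal_space A, S `<=` val y -> T `<=` ~` val y -> U y].
Proof.
move=> [D' D'D <-] [V D'V Vx]; have [E ED VE] := D'D _ D'V.
pose E' : {fset set (optimal_space A)} := E.
have {}VE : \bigcap_(W in [set` E']) W = V := VE.
have [| |S [T [Sfin Tfin Sx Tx ST]]] := @subbase_refine (optimal_space A) A
    (fun y => val y) [set` E'] x (finite_fset E').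
- by move=> W /ED /set_mem.
- by rewrite -VE in Vx => W EW; exact: Vx.
exists S, T; split=> // y Sy Ty; exists V => //.
by change (V y); rewrite -VE => W EW; exact: ST Sy Ty W EW.
Qed.

Lemma optimal_space_range (F : set A) :
  optimal_or_full F <-> exists x : optimal_space A, val x = F.
Proof.
split=> [Ff|[x <-]]; last exact: set_valP.
by exists (set_type_elt Ff).
Qed.

Lemma optimal_space_spectral : is_brouwerian A ->
  is_pges (@prime_points _ A) (@full_filter _ A) /\
  space_repr (@prime_points _ A) (fun x : optimal_space A => val x).
Proof.
move=> brwA.
have le x y : (x <= y) <-> (val (x : optimal_space A) `<=` val (y :
  optimal_space A)).
  by change (val x <= val y <-> val x `<=` val y); rewrite subsetEset.
have op a : open [set x : optimal_space A | val x a] /\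
    open [set x : optimal_space A | ~ val x a].
  by split; apply: optimal_space_open; exists a; [left|right].
split.
  exact (spectral_space_is_pges brwA le optimal_space_range (fun=> iff_refl _)
    (erefl : val (@full_filter _ A) = setT) op optimal_space_base).
exact (spectral_space_repr brwA le optimal_space_range (fun=> iff_refl _)
  op optimal_space_base).
Qed.

End optimal_space.

Lemma X_wf_holds : X_wf.
Proof. by move=> A; have [] := optimal_space_spectral (brwMSP A). Qed.

Section pseudoprime_space.
Context {d : Order.disp_t} {L : porderType d}.
Hypothesis brwL : is_brouwerian_frame L.
Implicit Types (p x y : L).

Let brwK : is_brouwerian (compacts_dual L).
Proof. by case: brwL. Qed.

(** This concerns the order of [L] itself, not the dual of its compact elements; it makes the
    separation theorem available for filters of [L]. *)
Lemma frame_is_brouwerian : is_brouwerian L.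
Proof.
have cr := compacts_below_repr brwL.
apply: is_brouwerianP.
- have [t tP] := frame_supremums brwL setT; exists t => x.
  by move/supremumsP : tP => /(_ t) [/(_ (lexx t)) + _]; apply.
- move=> a b; have [m mP] := filter_repr_surj cr
    (filter_setI brwK (filter_repr_filter cr a) (filter_repr_filter cr b)).
  by exists m; apply/infimums2P/(filter_repr_infimums2 brwK cr).
- move=> a b; have [c cP] := filter_repr_surj cr
    (filter_arrow brwK (filter_repr_filter cr a) (filter_repr_filter cr b)).
  exists c => x; rewrite (filter_repr_le cr) cP; split.
    move=> xc z za zx; apply/(filter_repr_le cr) => k kz.
    apply: (xc k) => //; [exact: le_trans zx|exact: le_trans za].
  move=> xab k kx f fa kf.
  apply: (xab (val (f : @compacts _ L))) => //=.
  apply: le_trans kx; exact: kf.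
Qed.

Lemma compacts_below_setT p : compacts_below p = setT <-> forall x, x <= p.
Proof.
split=> [pT x|px]; last by apply/seteqP; split=> // k _; exact: px.
by apply/(algebraic_le brwL); rewrite pT.
Qed.

(* The order of K(L)^d being reversed, the upper bounds of S are the compact
   elements below the meet of S in L. *)
Lemma compacts_dual_frink (S : set (compacts_dual L)) m (t : compacts_dual L) :
  infimums [set val (k : @compacts _ L) | k in S] m ->
  lbound (ubound S) t <-> m <= val (t : @compacts _ L).
Proof.
move=> /infimumsP mP; split=> [tS|mt u Su].
  apply/(algebraic_le brwL) => k km; apply: tS => s Ss.
  by apply: (le_trans km); apply: (mP m).1 (lexx m) _ _; exists s.
apply: (le_trans _ mt); apply/mP => _ [s Ss <-]; exact: Su.
Qed.

(** From left to right, primeness of the ideal passes from the meet of finitely many compact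
    elements to one of them. From right to left, the prime ideal is the complement of a prime filter
    of [L]. *)
Lemma pseudoprime_optimal p :
  pseudoprime p \/ (forall x, x <= p) <-> optimal_or_full (compacts_below p).
Proof.
split=> [[[I [[Idown Ij] Iproper Iprime] Ip]|/compacts_below_setT pT]|];
  last 2 first.
- by right.
- move=> [[_ pfr]|/compacts_below_setT]; last by right.
  left.
  (* The filter of [L] generated by the compact elements not below [p]; being above the meet of a
     finite set [S] of them is expressed as being above all its lower bounds. *)
  pose Phi : set L := [set x | exists2 S : set (compacts_dual L),
    finite_set S /\ S `<=` ~` compacts_below p &
    forall y, lbound [set val (k : @compacts _ L) | k in S] y -> y <= x].
  pose J : set L := [set val (k : @compacts _ L) | k in compacts_below p].
  have Phif : is_filter Phi.
    apply/(is_filterP frame_is_brouwerian); split.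
    - move=> x y [S SP Sx] xy; by exists S => // z Sz;
        exact: le_trans (Sx z Sz) xy.
    - exists set0 => [|y _]; last exact: le_top_of.
      by split=> //; exact: sub0set.
    - move=> x y [S [Sfin Sp] Sx] [T [Tfin Tp] Ty]; exists (S `|` T).
        by rewrite finite_setU; split=> // k [/Sp|/Tp].
      move=> z zST; rewrite le_meet_of Sx ?Ty //.
        by move=> _ [k Tk <-]; apply: zST; exists k => //; right.
      by move=> _ [k Sk <-]; apply: zST; exists k => //; left.
  have pf := compacts_below_filter brwL p.
  have [|||P [Pp PhiP PJ]] := prime_filter_extension frame_is_brouwerian Phif (D
    := J).
  - exists (val (top_of brwK : @compacts _ L)), (top_of brwK) => //;
      exact: filter_top.
  - move=> _ _ [a pa <-] [b pb <-].
    exists (val (meet_of brwK a b : @compacts _ L)); split.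
    + by exists (meet_of brwK a b) => //; exact: filter_meet.
    + exact: (meet_of_le brwK a b).1.
    + exact: (meet_of_le brwK a b).2.
  (* Disjointness is the Frink condition: a common element is a compact [t <= p] above the meet of a
     finite set of compact elements not below [p]. *)
  - rewrite -subset0 => x [[S [Sfin Sp] Sx] [t tp tx]].
    apply: (pfr S Sfin Sp t) => //.
    have [m mP] := frame_is_brouwerian.1 _
      (finite_image (fun k : compacts_dual L => val (k : @compacts _ L)) Sfin).
    by apply/(compacts_dual_frink _ mP); rewrite tx; apply: Sx; case: mP.
  have [Pf Pn Pd] := (prime_filterP frame_is_brouwerian P).1 Pp.
  exists (~` P).
    split.
    + split=> [x y nPy xy Px|S j Sfin SP Sj Pj].
        by apply: nPy; exact: filter_upset Pf _ _ Px xy.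
      have [c nPc Sc] := prime_filter_avoid frame_is_brouwerian Pp Sfin SP.
      by apply: nPc; apply: (filter_upset Pf Pj); move/supremumsP : Sj => ->.
    + move=> PT; have : P (top_of frame_is_brouwerian) by exact: filter_top.
      by rewrite -[P]setCK PT; apply.
    + move=> a b m mP nPm; have [Pa|] := pselect (P a); last by left.
      right=> Pb; apply: nPm; by apply: (Pf.2 [set a;
        b] m (finite_set2 a b) _ mP) => _ [->|->].
  (* The complement of [P] has supremum [p]: compact elements not below [p] are in [Phi], hence in
     [P], while those below [p] are in [J], hence outside [P]. *)
  apply/supremumsP => x; split=> [px y nPy|nPx].
    apply/(algebraic_le brwL) => k ky; apply: le_trans px.
    apply: contrapT => nkp; apply: nPy; apply: (filter_upset Pf _ ky).
    apply: PhiP; exists [set k]; first by split;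
      [exact: finite_set1|move=> _ ->].
    by move=> z; apply; exists k.
  apply/(algebraic_le brwL) => k kp; apply: nPx => Pk.
  have : set0 (val (k : @compacts _ L)) by rewrite -PJ; split=> //; exists k.
  by [].
left; split; first exact: compacts_below_filter.
move=> S Sfin Sp t tS tp.
have [m mP] := frame_is_brouwerian.1 _
  (finite_image (fun k : compacts_dual L => val (k : @compacts _ L)) Sfin).
have {}tS := (compacts_dual_frink t mP).1 tS.
have It : I (val (t : @compacts _ L)).
  have [T [u [Tfin TI Tu tu]]] := set_valP (t : @compacts _ L) I p Ip tp.
  by apply: Idown tu; exact: Ij Tu.
have {It tS tp} Im : I m by exact: Idown tS.
have nI k : S k -> ~ I (val (k : @compacts _ L)).
  move=> Sk Ik; apply: (Sp k Sk); move/supremumsP : Ip => /(_ p) [+ _].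
  by apply.
(* Elements are peeled off one at a time: primeness of [I] pushes the meet of the rest into [I], and
   the empty meet is the top, which a proper ideal omits. *)
move: Sfin nI mP {Sp} => /finite_seqP [l ->] {S}.
elim: l m Im => [|a l IHl] m Im lI mP.
  apply: Iproper; apply/seteqP; split=> // x _; apply: Idown Im _.
  by have /infimumsP /(_ x) [_] := mP; apply => y [].
have [n nP] := frame_is_brouwerian.1 _
  (finite_image (fun k : compacts_dual L => val (k : @compacts _ L)) (finite_seq
    l)).
have [||In] := Iprime (val (a : @compacts _ L)) n m _ Im.
- apply/infimumsP => x; have /infimumsP -> := mP; split.
    move=> xl _ [->|->]; first by apply: xl; exists a => //;
      rewrite /= mem_head.
    have /infimumsP -> := nP => _ [k kl <-]; apply: xl; exists k => //.
    by rewrite /= inE kl orbT.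
  move=> xan _ [k kal <-]; have : k \in a :: l := kal.
  rewrite inE => /predU1P [->|kl]; first by apply: xan; left.
  apply: (le_trans (xan n _)); first by right.
  by have /infimumsP /(_ n) [/(_ (lexx n)) + _] := nP; apply; exists k.
- exact: (lI a (mem_head a l)).
apply: (IHl n In) => // k kl; apply: lI; rewrite /= inE kl; exact: orbT.
Qed.

End pseudoprime_space.

Lemma order_iso_meet_prime d d' (T : porderType d) (T' : porderType d')
    (f : T -> T') p : order_iso f -> meet_prime (f p) <-> meet_prime p.
Proof.
move=> fiso; have [fle fsurj] := fiso; split=> -[pn pm]; split.
- by move=> px; apply: pn => y; have [x <-] := fsurj y; rewrite fle.
- by move=> a b m /(order_iso_infimums2 fiso) /pm; rewrite !fle.
- by move=> px; apply: pn => x; rewrite -fle.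
- move=> a b m; have [{}a <-] := fsurj a; have [{}b <-] := fsurj b.
  by have [{}m <-] := fsurj m; rewrite order_iso_infimums2 // !fle; apply: pm.
Qed.

Section pseudoprime_space_repr.
Context {d : Order.disp_t} {L : porderType d}.
Hypothesis brwL : is_brouwerian_frame L.

Lemma pseudoprime_space_open (U : set (pseudoprime_space L)) :
  (exists2 k, compact_element k & U = principal_up k \/ U = ~` principal_up k)
    ->
  open U.
Proof.
move=> Usub; exists [set U]; last by rewrite bigcup_set1.
by move=> _ ->; apply: (@finI_from1 _ _ _ id).
Qed.

Lemma pseudoprime_space_base (x : pseudoprime_space L) U : open U -> U x ->
  exists S T, [/\ finite_set S, finite_set T, S `<=` compacts_below (val x),
    T `<=` ~` compacts_below (val x) & forall y : pseudoprime_space L,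
    S `<=` compacts_below (val y) -> T `<=` ~` compacts_below (val y) -> U y].
Proof.
move=> [D' D'D <-] [V D'V Vx]; have [E ED VE] := D'D _ D'V.
pose E' : {fset set (pseudoprime_space L)} := E.
have {}VE : \bigcap_(W in [set` E']) W = V := VE.
have [| |S [T [Sfin Tfin Sx Tx ST]]] := @subbase_refine (pseudoprime_space L)
    (compacts_dual L) (fun y => compacts_below (val y)) [set` E'] x (finite_fset
      E').
- by move=> W /ED /set_mem [k kc WE]; exists (set_type_elt kc).
- by rewrite -VE in Vx => W EW; exact: Vx.
exists S, T; split=> // y Sy Ty; exists V => //.
by change (V y); rewrite -VE => W EW; exact: ST Sy Ty W EW.
Qed.

Lemma pseudoprime_space_range (F : set (compacts_dual L)) : optimal_or_full F
  <->
  exists x : pseudoprime_space L, compacts_below (val x) = F.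
Proof.
have [_ _ brwK] := brwL; split=> [Fo|[x <-]]; last first.
  by apply/(pseudoprime_optimal brwL); exact: (set_valP (x : @pseudoprime_or_top
    _ L)).
have [x xF] := filter_repr_surj (compacts_below_repr brwL)
  (optimal_or_full_filter brwK Fo).
have xP : pseudoprime x \/ forall y, y <= x.
  by apply/(pseudoprime_optimal brwL); rewrite xF.
by exists (set_type_elt (xP : @pseudoprime_or_top _ L x)).
Qed.

(** Meet-primeness is invariant under the isomorphism of [L] with the filters of the dual of its
    compact elements. *)
Lemma pseudoprime_space_core (x : pseudoprime_space L) :
  prime_elements x <-> prime_filter (compacts_below (val x)).
Proof.
have [f [fiso fE]] := filter_repr_order_iso (compacts_below_repr brwL)
  (filters_repr (compacts_dual L)).
rewrite /prime_elements /= -(order_iso_meet_prime _ fiso);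
  split=> [xp|[Q QE Qp]].
  by exists (f (val x)); rewrite ?fE.
rewrite (_ : f (val x) = Q) //.
by apply: val_inj; rewrite QE fE.
Qed.

Lemma pseudoprime_space_spectral (m : pseudoprime_space L) :
  (forall x : L, x <= val m) -> is_pges (@prime_elements _ L) m /\
  space_repr (@prime_elements _ L)
    (fun x : pseudoprime_space L => compacts_below (val x)).
Proof.
move=> mmax; have [_ _ brwK] := brwL.
have le (x y : pseudoprime_space L) :
    (x <= y) <-> compacts_below (val x) `<=` compacts_below (val y).
  exact: (algebraic_le brwL (val x) (val y)).
have op a : open [set x : pseudoprime_space L | compacts_below (val x) a] /\
    open [set x : pseudoprime_space L | ~ compacts_below (val x) a].
  by split; apply: pseudoprime_space_open; exists (val (a : @compacts _ L));
    [exact: set_valP|left|exact: set_valP|right].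
have mT : compacts_below (val m) = setT by apply/compacts_below_setT.
split.
  exact (spectral_space_is_pges brwK le pseudoprime_space_range
    pseudoprime_space_core mT op pseudoprime_space_base).
exact (spectral_space_repr brwK le pseudoprime_space_range
  pseudoprime_space_core op pseudoprime_space_base).
Qed.

End pseudoprime_space_repr.

Lemma top_element_max (L : brwFrm) (x : L) : x <= val (top_element L).
Proof. by rewrite /top_element; case: cid. Qed.

Lemma Y_wf_holds : Y_wf.
Proof.
by move=> L; have [] := pseudoprime_space_spectral (brwFrmP L) (@top_element_max
  L).
Qed.

(** * Admissible clopen upsets *)

Section admissible.
Variable X : pges.

Let X0 := pges_core X.
Let m := pges_max X.
Let AX : porderType _ := adm_clopen_upsets X0.

Lemma adm_le (U V : AX) : (U <= V) <-> val U `<=` val V.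
Proof. by change (val U <= val V <-> val U `<=` val V); rewrite subsetEset. Qed.

Lemma adm_core_avoiding (U : set X) (x : X) : admissible X0 U -> ~ U x ->
  exists y, [/\ X0 y, x <= y & ~ U y].
Proof. by move=> Ua nUx; have [y [Xy nUy] xy] := Ua x nUx; exists y. Qed.

Lemma pges_compact : compact [set: X].
Proof. by case: (pgesP X) => -[[[]]]. Qed.

Lemma pges_max_top (x : X) : x <= m.
Proof. by case: (pgesP X) => -[[_ H] _ _ _] _. Qed.

Lemma pges_leP (x y : X) : x <= y <->
  (forall U, adm_clopen_upsets X0 U -> U x -> U y).
Proof. by case: (pgesP X) => -[_ _ _ H] _. Qed.

Lemma pges_coreP (x : X) :
  X0 x <-> adm_avoiding X0 x !=set0 /\ directed (adm_avoiding X0 x).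
Proof. by case: (pgesP X) => -[_ _ H _] _. Qed.

Lemma pges_avoid (x : X) (S : set (set X)) : X0 x -> finite_set S ->
  S `<=` adm_avoiding X0 x ->
  exists2 U, adm_avoiding X0 x U & forall V, S V -> V `<=` U.
Proof.
move=> /pges_coreP [ne di] Sfin Sx; have [U xU SU] :=
  directed_finite ne di Sfin Sx.
by exists U => // V /SU; rewrite subsetEset.
Qed.

Lemma adm_setT : adm_clopen_upsets X0 setT.
Proof. by split=> //; [move=> x /(_ I)|split;
  [exact: openT|exact: closedT]]. Qed.

Lemma admissible_setI (U V : set X) :
  admissible X0 U -> admissible X0 V -> admissible X0 (U `&` V).
Proof.
move=> Ua Va x; rewrite setCI => -[/Ua|/Va] [y [Xy ny] xy];
by exists y => //; split=> // -[].
Qed.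

Lemma adm_setI (U V : set X) : adm_clopen_upsets X0 U ->
  adm_clopen_upsets X0 V -> adm_clopen_upsets X0 (U `&` V).
Proof.
move=> [Ua [Uo Uc] Uup] [Va [Vo Vc] Vup]; split.
- exact: admissible_setI.
- by split; [exact: openI|exact: closedI].
- by move=> x y [Ux Vx] xy; split; [exact: Uup xy|exact: Vup xy].
Qed.

(** Clopenness is the Esakia condition. For admissibility, a point of [U] outside [V] lies below a
    core point outside [V], which is still in the upset [U]. *)
Lemma adm_arrow (U V : set X) : adm_clopen_upsets X0 U ->
  adm_clopen_upsets X0 V ->
  adm_clopen_upsets X0 (~` downclosure (U `\` V)).
Proof.
move=> UU VV; split.
- move=> x; rewrite setCK => -[y [Uy nVy] xy].
  have [Va _ _] := VV; have [z [Xz yz nVz]] := adm_core_avoiding Va nVy.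
  exists z; last exact: le_trans yz.
  by split=> //; apply; exists z => //; split=> //; have [_ _ Uup] := UU;
    exact: Uup yz.
- by apply: (@clopenC _ _ set0); case: (pgesP X) => _; apply.
- by move=> x y nx xy [z UVz yz]; apply: nx; exists z => //; exact: le_trans yz.
Qed.

Lemma adm_brouwerian : is_brouwerian AX.
Proof.
apply: is_brouwerianP.
- by exists (set_type_elt adm_setT) => U; apply/adm_le.
- move=> U V; exists (set_type_elt (adm_setI (set_valP U) (set_valP V))) => W.
  apply/idP/andP => [/adm_le /= WUV|[/adm_le WU /adm_le WV]].
    by split; apply/adm_le => x /WUV [].
  by apply/adm_le => x Wx; split; [exact: WU|exact: WV].
- move=> U V; exists (set_type_elt (adm_arrow (set_valP U) (set_valP V))) => W.
  rewrite adm_le /=; split=> [WUV Z /adm_le ZU /adm_le ZW|H x Wx [y [Uy nVy]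
    xy]].
    apply/adm_le => x Zx; apply: contrapT => nVx.
    by apply: (WUV x (ZW _ Zx)); exists x => //; split=> //; exact: ZU.
  pose Z : AX := set_type_elt (adm_setI (set_valP U) (set_valP W)).
  have /adm_le ZV : Z <= V by apply: H; apply/adm_le => z [].
  apply: nVy; apply: ZV; split=> //.
  by have [_ _ Wup] := set_valP W; exact: Wup xy.
Qed.

Definition adm_at (x : X) : set AX := [set U | val U x].

Lemma adm_at_filter x : is_filter (adm_at x).
Proof.
split=> [U V Ux /adm_le|S U Sfin Sx]; first exact.
have [l lS] := (finite_seqP S).1 Sfin.
suff [W [Wx WS]] : exists W : AX, val W x /\ forall V, S V -> W <= V.
  by move=> /infimumsP /(_ W) [_ /(_ WS)] /adm_le; apply.
rewrite lS in Sx *; elim: l {Sfin lS} Sx => [|V l IHl] Sx.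
  by exists (set_type_elt adm_setT).
have [W [Wx Wl]] := IHl (fun V' Vl => Sx V' (mem_behead (s := V :: l) Vl)).
exists (set_type_elt (adm_setI (set_valP V) (set_valP W))); split.
  by split=> //; exact: (Sx V (mem_head V l)).
move=> V'; rewrite /= inE => /predU1P [->|V'l]; first by apply/adm_le => y [].
by apply: (le_trans _ (Wl V' V'l)); apply/adm_le => y [].
Qed.

(** The axiom characterising the core by [adm_avoiding] is [prime_filterP] read in the semilattice
    of admissible clopen upsets. *)
Lemma adm_at_prime x : prime_filter (adm_at x) <-> X0 x.
Proof.
rewrite (prime_filterP adm_brouwerian) pges_coreP.
split=> [[_ xn xd]|[[U [UU nUx]] xd]].
  split.
    apply: contrapT => ne; apply: xn; apply/seteqP; split=> // U _.
    by apply: contrapT => nUx; apply: ne; exists (val U); split=> //;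
      exact: set_valP.
  move=> U V [UU nUx] [VV nVx].
  have [W [nWx /adm_le UW /adm_le VW]] :=
    xd (set_type_elt UU) (set_type_elt VV) nUx nVx.
  by exists (val W); rewrite !subsetEset; split=> //; split=> //;
    exact: set_valP.
split; first exact: adm_at_filter.
  by move=> xT; apply: nUx; change (adm_at x (set_type_elt UU)); rewrite xT.
move=> V W nVx nWx.
have [Z [[ZZ nZx]]] := xd (val V) (val W) (conj (set_valP V) nVx) (conj
  (set_valP W) nWx).
rewrite !subsetEset => VZ WZ.
by exists (set_type_elt ZZ); split=> //; apply/adm_le.
Qed.

(** An admissible set missing [m] would give a core point above [m], that is [m] itself, which is
    not in the core. *)
Lemma adm_at_max : adm_at m = setT.
Proof.
apply/seteqP; split=> // U _; rewrite /adm_at /=; apply: contrapT => nUm.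
have [Ua _ _] := set_valP U; have [y [Xy my _]] := adm_core_avoiding Ua nUm.
have [[_ [/(_ _ Xy) ym _ _] _ _] _] := pgesP X.
by apply: ym; apply/le_anti/andP; split; [exact: pges_max_top|].
Qed.

(* The core is dense, so a point other than the maximum which lies in V and
   avoids a finite set S may be replaced by a core point. *)
Lemma adm_at_optimal x : optimal_or_full (adm_at x).
Proof.
have [->|/eqP xm] := eqVneq x m; first by right; exact: adm_at_max.
left; apply/optimal_filterP; split; first exact: adm_at_filter.
move=> S V Sfin Sx Vx.
have [[_ [_ /(_ x xm) xcl _] _ _] _] := pgesP X.
have [|y [Xy yB]] := xcl (val V `&` ~` \bigcup_(U in S) val U).
  apply: open_nbhs_nbhs; split; last by split=> // -[U /Sx].
  apply: openI; first by have [_ []] := set_valP V.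
  by apply/closed_openC/closed_bigcup => // U _; have [_ []] := set_valP U.
have [Vy Sy] := yB.
have [|W [WW nWy] SW] := pges_avoid Xy (finite_image (fun U : AX => val U)
  Sfin).
  by move=> _ [U SU <-]; split; [exact: set_valP|move=> Uy; apply: Sy;
    exists U].
exists (set_type_elt WW); first by move=> U SU; apply/adm_le/SW; exists U.
by apply/negP => /adm_le /(_ y Vy).
Qed.

(** If no point realised an optimal [F], the complements of its members together with the
    non-members would cover [X]. In a finite subcover, the meet [t] of the members involved would be
    below every upper bound [u] of the non-members involved, against optimality. *)
Lemma adm_at_surj F : optimal_or_full F -> exists x, adm_at x = F.
Proof.
move=> [|->]; last by exists m; exact: adm_at_max.
move=> /(optimal_filterP) [Ff FC].
pose D := [set W : set X | exists U : AX,
  F U /\ W = ~` val U \/ ~ F U /\ W = val U].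
apply: contrapT => nx.
have [||S [Sfin SD ST]] := @compact_subcover X _ setT D id pges_compact
  (@closedT _).
- move=> W [U [[_ ->]|[_ ->]]]; have [_ [Uo Uc] _] := set_valP U => //.
  exact: closed_openC.
- move=> x _; apply: contrapT => nW; apply: nx; exists x; apply/seteqP;
    split=> U.
    move=> Ux; apply: contrapT => nFU; apply: nW; exists (val U) => //.
    by exists U; right.
  move=> FU; apply: contrapT => nUx; apply: nW; exists (~` val U) => //.
  by exists U; left.
have /choice [g gP] : forall W, exists U : AX,
    S W -> F U /\ W = ~` val U \/ ~ F U /\ W = val U.
  move=> W; have [SW|nSW] := pselect (S W);
    last by exists (set_type_elt adm_setT).
  by have [U UP] := SD W SW; exists U.
have gfin := finite_image g Sfin.
have [t St] := adm_brouwerian.1 _ (sub_finite_set (@subIsetl _ _ F) gfin).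
have Ft : F t by apply: (Ff.2 _ _ (sub_finite_set (@subIsetl _ _ F) gfin)) St =>
  U [].
have [||u Su /negP] := FC (g @` S `&` ~` F) t _ _ Ft.
- exact: sub_finite_set gfin.
- by move=> U [].
apply; apply/adm_le => x tx; have [W SW Wx] := ST x I.
have gSW : (g @` S) (g W) by exists W.
have [[FW WE]|[nFW WE]] := gP W SW; move: Wx; rewrite /= WE => Wx.
  case: Wx; have /infimumsP /(_ t) [/(_ (lexx t)) tl _] := St.
  by have /adm_le := tl (g W) (conj gSW FW); apply.
by have /adm_le := Su (g W) (conj gSW nFW); apply.
Qed.

Lemma adm_at_repr : space_repr X0 adm_at.
Proof.
split.
- move=> x y; rewrite pges_leP; split=> [H U Ux|H U UU Ux].
    exact: (H _ (set_valP U)).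
  exact: (H (set_type_elt UU)).
- move=> F; split; [exact: adm_at_surj|move=> [x <-]; exact: adm_at_optimal].
- by move=> x; rewrite adm_at_prime.
- move=> U; split=> [UU|[V ->]]; last exact: (set_valP V).
  by exists (set_type_elt UU).
Qed.

End admissible.

Lemma A_wf_holds : A_wf.
Proof. by move=> X; exact: adm_brouwerian. Qed.

(** * The duality between Brouwerian semilattices and spaces *)

Section hom_lift.
Variables (A B : brwMS) (h : A -> B).
Hypothesis hhom : is_brwMS_hom h.

Let brwA := brwMSP A.
Let brwB := brwMSP B.

(* The lift avoids h a for a outside Q; that the filter generated by F and
   h Q does so is where preservation of implication enters. *)
Lemma brwMS_hom_prime_lift (F : set B) (Q : set A) :
  is_filter F -> prime_filter Q -> h @^-1` F `<=` Q ->
  exists P, [/\ prime_filter P, F `<=` P & h @^-1` P = Q].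
Proof.
move=> Ff Qp FQ; have [Qf Qn Qd] := (prime_filterP brwA Q).1 Qp.
pose G := [set b | exists2 c, F c & exists2 a, Q a & meet_of brwB c (h a) <= b].
pose D := [set h a | a in ~` Q].
have Gf : is_filter G.
  apply/(is_filterP brwB); split.
  - move=> x y [c Fc [a Qa cax]] xy.
    by exists c => //; exists a => //; exact: le_trans xy.
  - exists (top_of brwB); first exact: filter_top.
    by exists (top_of brwA); [exact: filter_top|exact: le_top_of].
  - move=> x y [c Fc [a Qa cax]] [c' Fc' [a' Qa' cay]].
    exists (meet_of brwB c c'); first exact: filter_meet.
    exists (meet_of brwA a a'); first exact: filter_meet.
    rewrite (brwMS_hom_meet hhom) le_meet_of; apply/andP; split.
      apply: le_trans cax; rewrite le_meet_of; apply/andP; split.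
        exact: le_trans (meet_of_le _ _ _).1 (meet_of_le _ _ _).1.
      exact: le_trans (meet_of_le _ _ _).2 (meet_of_le _ _ _).1.
    apply: le_trans cay; rewrite le_meet_of; apply/andP; split.
      exact: le_trans (meet_of_le _ _ _).1 (meet_of_le _ _ _).2.
    exact: le_trans (meet_of_le _ _ _).2 (meet_of_le _ _ _).2.
have [|||P [Pp GP PD]] := prime_filter_extension brwB Gf (D := D).
- have /existsNP [a nQa] : ~ forall a, Q a.
    by move=> QT; apply: Qn; apply/seteqP; split.
  by exists (h a), a.
- move=> _ _ [a nQa <-] [b nQb <-]; have [c [nQc ac bc]] := Qd _ _ nQa nQb.
  by exists (h c); split; [exists c|exact: brwMS_hom_le hhom _ _ ac|exact:
    brwMS_hom_le hhom _ _ bc].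
- rewrite -subset0 => x [[c Fc [a Qa cax]] [a' nQa' ax]]; apply: nQa'.
  (* From [c /\ h a <= h a'] follows [c <= h (a -> a')], so [a -> a'] is in the preimage of [F],
     hence in [Q], and modus ponens puts [a'] in [Q]. *)
  have /FQ Qaa' : (h @^-1` F) (imp_of brwA a a').
    rewrite /= (brwMS_hom_imp hhom); apply: (filter_upset Ff Fc).
    rewrite le_imp_of ax; apply: le_trans cax; rewrite le_meet_of.
    by rewrite (meet_of_le _ _ _).1 (meet_of_le _ _ _).2.
  apply: (filter_upset Qf (filter_meet brwA Qf Qa Qaa')).
  by rewrite -le_imp_of.
exists P; split=> //.
  move=> c Fc; apply: GP; exists c => //; exists (top_of brwA);
    first exact: filter_top.
  by rewrite meet_of_le.
apply/seteqP; split=> a.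
  move=> Pa; apply: contrapT => nQa; have : set0 (h a); last by [].
  by rewrite -PD; split=> //; exists a.
move=> Qa; apply: GP; exists (top_of brwB); first exact: filter_top.
by exists a => //; rewrite meet_of_le.
Qed.

(** Some prime filter contains [h t] and avoids [h s] for all [s] in [S]; its preimage is prime, so
    [S] has an upper bound outside that preimage, and [t] is not below it. *)
Lemma brwMS_hom_preimage_optimal (F : set B) :
  optimal_or_full F -> optimal_or_full (h @^-1` F).
Proof.
move=> [|->]; last by right.
move=> Fo; left; apply/optimal_filterP; have [Ff _] := Fo.
split; first exact: brwMS_hom_preimage_filter.
move=> S t Sfin SF Ft.
have [|P [Pp Pt SP]] := prime_filters_dense brwB Fo Ft (finite_image h Sfin).
  by move=> _ [s /SF nFs <-].
have [_ _ _ /(_ _ Pp) hPp] := hhom.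
have [|c nPc Sc] := prime_filter_avoid brwA hPp Sfin.
  by move=> s Ss; apply: SP; exists s.
exists c => //; apply/negP => tc; apply: nPc.
exact: (filter_upset (prime_filter_filter brwA hPp) Pt tc).
Qed.

(** Reduces being a morphism of spaces to being a preimage map on the represented filters. Taking
    [h] to be the identity also makes two spaces representing the same semilattice isomorphic. *)
Lemma space_repr_hom (X Y : pges) (e : X -> set B) (e' : Y -> set A) (f : X ->
  Y) :
  space_repr (pges_core X) e -> space_repr (pges_core Y) e' ->
  (forall x, e' (f x) = h @^-1` e x) -> is_pges_hom f.
Proof.
move=> [Xle Xrange Xcore Xadm] [Yle Yrange Ycore Yadm] fE; split.
- move=> x y /Xle xy; apply/Yle; rewrite !fE => a; exact: xy.
- move=> U /Yadm [a ->]; apply/Xadm; exists (h a).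
  by apply/seteqP; split=> x /=; rewrite fE.
- move=> _ [x /Xcore xp <-]; apply/Ycore; rewrite fE.
  by have [_ _ _] := hhom; apply.
- move=> x y /Ycore yp /Yle; rewrite fE => xy.
  have xf : is_filter (e x).
    by apply: (optimal_or_full_filter brwB); apply/Xrange; exists x.
  have [P [Pp xP Py]] := brwMS_hom_prime_lift xf yp xy.
  have /Xrange [z zP] : optimal_or_full P by left;
    exact: prime_filter_optimal Pp.
  exists z; split; first by apply/Xcore; rewrite zP.
    by apply/Xle; rewrite zP.
  by apply/le_anti/andP; split; apply/Yle; rewrite fE zP Py.
Qed.

End hom_lift.

Lemma space_repr_iso (X Y : pges) (A : brwMS) (e : X -> set A) (e' : Y ->
  set A) :
  space_repr (pges_core X) e -> space_repr (pges_core Y) e' ->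
  exists (f : pges_hom X Y) (g : pges_hom Y X),
    [/\ forall x, e' (sval f x) = e x, forall y, e (sval g y) = e' y,
        @comp PGES_P X Y X g f = @idc PGES_P X &
        @comp PGES_P Y X Y f g = @idc PGES_P Y].
Proof.
move=> Xr Yr; have [Xle Xrange _ _] := Xr; have [Yle Yrange _ _] := Yr.
have /choice [f fE] : forall x, exists y, e' y = e x.
  by move=> x; apply/Yrange/Xrange; exists x.
have /choice [g gE] : forall y, exists x, e x = e' y.
  by move=> y; apply/Xrange/Yrange; exists y.
have idh := is_brwMS_hom_id A.
have fh : is_pges_hom f by exact (space_repr_hom idh Xr Yr fE).
have gh : is_pges_hom g by exact (space_repr_hom idh Yr Xr gE).
exists (exist _ f fh), (exist _ g gh); split=> //; apply: sval_inj;
  apply/funext => x /=.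
  by apply/le_anti/andP; split; apply/Xle; rewrite gE fE.
by apply/le_anti/andP; split; apply/Yle; rewrite fE gE.
Qed.

Lemma space_repr_adm (Z : pges) d (A : porderType d) (e : Z -> set A) :
  is_brouwerian A -> space_repr (pges_core Z) e ->
  exists p : A -> adm_clopen_upsets (pges_core Z),
    order_iso p /\ forall a, val (p a) = [set x | e x a].
Proof.
move=> brwA [Zle Zrange Zcore Zadm].
have pa a : adm_clopen_upsets (pges_core Z) [set x | e x a] by apply/Zadm;
  exists a.
exists (fun a => set_type_elt (pa a)); split=> //; split=> [a b|U].
  apply/idP/idP => [/adm_le /= ab|ab].
    apply/negPn/negP => nab; have [P [Pp Pa nPb]] := prime_filter_le brwA nab.
    have /Zrange [x xP] : optimal_or_full P by left;
      exact: (prime_filter_optimal brwA).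
    by apply: nPb; rewrite -xP; apply: ab; rewrite /= xP.
  apply/adm_le => x xa; have xf : is_filter (e x).
    by apply: (optimal_or_full_filter brwA); apply/Zrange; exists x.
  exact: filter_upset xf _ _ xa ab.
have /Zadm [a aE] := set_valP U; exists a; apply: val_inj.
by rewrite aE.
Qed.

Lemma optimal_space_repr (A : brwMS) :
  space_repr (@prime_points _ A) (fun x : optimal_space A => val x).
Proof. by have [] := optimal_space_spectral (brwMSP A). Qed.

Lemma X_functor_ex :
  exists X : functor (op_cat BrwMS_P) PGES_P (X_obj X_wf_holds), X_spec X.
Proof.
pose X0 (A B : brwMS) (h : brwMS_hom A B) (x : optimal_space B) : optimal_space
  A :=
  set_type_elt (brwMS_hom_preimage_optimal (svalP h) (set_valP x)).
have Xh (A B : brwMS) (h : brwMS_hom A B) :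
    @is_pges_hom (X_obj X_wf_holds B) (X_obj X_wf_holds A) (X0 A B h).
  exact (@space_repr_hom A B _ (svalP h) (X_obj X_wf_holds B) (X_obj X_wf_holds
    A)
    _ _ (X0 A B h) (optimal_space_repr B) (optimal_space_repr A) (fun=> erefl)).
pose X1 (B A : op_cat BrwMS_P) (h : hom B A) :
    @hom PGES_P (X_obj X_wf_holds B) (X_obj X_wf_holds A) :=
      exist _ _ (Xh A B h).
have X1id (A : op_cat BrwMS_P) : X1 A A (idc A) = idc _.
  by apply: sval_inj; apply/funext => x; apply: val_inj.
have X1M (A B C : op_cat BrwMS_P) (f : hom B C) (g : hom A B) :
    X1 A C (comp f g) = comp (X1 B C f) (X1 A B g).
  by apply: sval_inj; apply/funext => x; apply: val_inj.
by exists (@Functor (op_cat BrwMS_P) PGES_P (X_obj X_wf_holds) X1 X1id X1M).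
Qed.

Section adm_preimage.
Variables (X Y : pges) (f : X -> Y).
Hypothesis fhom : is_pges_hom f.

Let AX : porderType _ := adm_clopen_upsets (pges_core X).
Let AY : porderType _ := adm_clopen_upsets (pges_core Y).

Definition adm_preimage (U : AY) : AX :=
  set_type_elt (let: And4 _ fU _ _ := fhom in fU _ (set_valP U)).

Lemma adm_preimage_meets : preserves_finite_meets adm_preimage.
Proof.
move=> S m Sfin Sm; apply/infimumsP => Z; split=> [/adm_le Zm _ [U SU <-]|ZS].
  apply/adm_le => x /Zm /=; have /infimumsP /(_ m) [/(_ (lexx m) U SU)] := Sm.
  by move=> /adm_le mU _; exact: mU.
apply/adm_le => x Zx; apply: ((adm_at_filter (f x)).2 S m Sfin _ Sm) => U SU.
by have /adm_le := ZS (adm_preimage U) (ex_intro2 _ _ U SU erefl); exact.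
Qed.

Lemma adm_implicationP (Z : pges) (U V W : adm_clopen_upsets (pges_core Z)) :
  is_implication U V W <-> val W = ~` downclosure (val U `\` val V).
Proof.
pose W' : adm_clopen_upsets (pges_core Z) :=
  set_type_elt (adm_arrow (set_valP U) (set_valP V)).
have W'P : is_implication U V W'.
  move=> T m /infimums2P mP; apply/idP/idP => [/adm_le TW|/adm_le mV].
    have := lexx m; rewrite mP => /andP [/adm_le mU /adm_le mT].
    apply/adm_le => x mx; apply: contrapT => nVx.
    by apply: (TW x (mT x mx)); exists x => //; split=> //; exact: mU.
  apply/adm_le => x Tx [y [Uy nVy] xy]; apply: nVy; apply: mV.
  pose UT : adm_clopen_upsets (pges_core Z) :=
    set_type_elt (adm_setI (set_valP U) (set_valP T)).
  have /adm_le : UT <= m.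
    by rewrite mP; apply/andP; split; apply/adm_le => z [].
  apply; split=> //; have [_ _ Tup] := set_valP T; exact: Tup xy.
have unique W1 W2 : is_implication U V W1 -> is_implication U V W2 -> W1 <= W2.
  move=> H1 H2; have Hm := infimums_meet_of (adm_brouwerian Z) U W1.
  by rewrite (H2 _ _ Hm) -(H1 _ _ Hm).
split=> [WP|WE]; last by have -> : W = W' by apply: val_inj.
by have -> : W = W' by apply/le_anti; rewrite !unique.
Qed.

(** The lifting condition enters here: a point of [U] outside [V] above [f x] is first moved up to a
    core point, which then lifts to a point above [x]. *)
Lemma adm_preimage_implication : preserves_implication adm_preimage.
Proof.
have [fle _ fcore flift] := fhom.
move=> U V W /adm_implicationP WE; apply/adm_implicationP => /=.
rewrite WE; apply/seteqP; split=> x nx [y [Uy nVy] xy]; apply: nx.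
  by exists (f y) => //; exact: fle.
have [Va _ _] := set_valP V; have [z [Yz yz nVz]] := adm_core_avoiding Va nVy.
have [w [_ xw wz]] := flift x z Yz (le_trans xy yz).
exists w => //; split=> /=; rewrite wz //.
by have [_ _ Uup] := set_valP U; exact: Uup yz.
Qed.

(** At a core point, directedness of [adm_avoiding] merges the members of [S] that avoid the point
    into a single upper bound that still avoids it. *)
Lemma adm_supremum_core (Z : pges) (S : set (adm_clopen_upsets (pges_core Z))) W
  z :
  finite_set S -> supremums S W -> pges_core Z z -> val W z ->
  exists2 U, S U & val U z.
Proof.
move=> Sfin SW Zz Wz; apply: contrapT => nS.
have [|T [TT nTz] ST] := pges_avoid Zz
    (finite_image (fun U : adm_clopen_upsets (pges_core Z) => val U) Sfin).
  move=> _ [U SU <-]; split; first exact: set_valP.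
  by move=> Uz; apply: nS; exists U.
apply: nTz; have /supremumsP /(_ (set_type_elt TT)) [_ WT] := SW.
have /WT /adm_le : forall U, S U -> U <= set_type_elt TT; last exact.
by move=> U SU; apply/adm_le/ST; exists U.
Qed.

Lemma adm_preimage_joins : preserves_finite_joins adm_preimage.
Proof.
have [_ _ fcore _] := fhom.
move=> S W Sfin SW; apply/supremumsP => Z; split=> [/adm_le WZ _ [U SU <-]|SZ].
  apply/adm_le => x /= Ux; apply: WZ => /=.
  have /supremumsP /(_ W) [/(_ (lexx W) U SU) /adm_le UW _] := SW.
  exact: UW.
apply/adm_le => x /= Wx; apply: contrapT => nZx.
have [Za _ _] := set_valP Z; have [z [Xz xz nZz]] := adm_core_avoiding Za nZx.
have Wz : val W (f z).
  have [fle _ _ _] := fhom; have [_ _ Wup] := set_valP W;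
    exact: Wup Wx (fle _ _ xz).
have Yz : pges_core Y (f z) by apply: fcore; exists z.
have [U SU Uz] := adm_supremum_core Sfin SW Yz Wz; apply: nZz.
by have /adm_le := SZ (adm_preimage U) (ex_intro2 _ _ U SU erefl); exact.
Qed.

(** A prime filter is [adm_at x] for a core point [x], and its preimage is [adm_at (f x)]. *)
Lemma adm_preimage_prime P : prime_filter P ->
  prime_filter (adm_preimage @^-1` P).
Proof.
move=> Pp; have [x xP] := adm_at_surj (or_introl (prime_filter_optimal
  (adm_brouwerian X) Pp)).
rewrite -xP in Pp *; have Xx := (adm_at_prime x).1 Pp.
have -> : adm_preimage @^-1` adm_at x = adm_at (f x) by [].
by apply/adm_at_prime; have [_ _ fcore _] := fhom; apply: fcore; exists x.
Qed.

Lemma adm_preimage_hom :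
  @is_brwMS_hom (BrwMSObj (A_wf_holds Y)) (BrwMSObj (A_wf_holds X))
    adm_preimage.
Proof.
split; [exact: adm_preimage_meets|exact: adm_preimage_implication|
  exact: adm_preimage_joins|exact: adm_preimage_prime].
Qed.

End adm_preimage.

Lemma A_functor_ex :
  exists A : functor PGES_P (op_cat BrwMS_P) (A_obj A_wf_holds), A_spec A.
Proof.
pose A1 (X Y : PGES_P) (f : hom X Y) :
    @hom (op_cat BrwMS_P) (A_obj A_wf_holds X) (A_obj A_wf_holds Y) :=
  exist _ _ (adm_preimage_hom (svalP f)).
have A1id (X : PGES_P) : A1 X X (idc X) = idc _.
  by apply: sval_inj; apply/funext => x; apply: val_inj.
have A1M (X Y Z : PGES_P) (f : hom Y Z) (g : hom X Y) :
    A1 X Z (comp f g) = comp (A1 Y Z f) (A1 X Y g).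
  by apply: sval_inj; apply/funext => x; apply: val_inj.
by exists (@Functor PGES_P (op_cat BrwMS_P) (A_obj A_wf_holds) A1 A1id A1M).
Qed.

Section AX_XA.
Variables (X : functor (op_cat BrwMS_P) PGES_P (X_obj X_wf_holds)).
Variables (A : functor PGES_P (op_cat BrwMS_P) (A_obj A_wf_holds)).
Hypotheses (XP : X_spec X) (AP : A_spec A).

Lemma XA_nat_iso : nat_iso (X \oF A) (id_functor PGES_P).
Proof.
apply: nat_iso_sym.
pose p (Z : pges) := cid (@space_repr_iso Z (X_obj X_wf_holds (A_obj A_wf_holds
  Z))
  (A_obj A_wf_holds Z) _ _ (adm_at_repr Z) (optimal_space_repr _)).
exists (fun Z => sval (p Z)); split=> [Y Z f|Z]; last first.
  by rewrite /p; case: cid => g /= [g' [_ _ gK g'K]]; exists g'.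
have pE (W : pges) x : val (sval (sval (p W)) x) = adm_at x.
  by rewrite /p; case: cid => g /= [g' [-> _ _ _]].
apply: sval_inj; apply/funext => x; apply: val_inj.
apply: etrans (XP _ _) _; apply: etrans _ (esym (pE Z _)).
rewrite pE; apply/seteqP.
have AE := AP f.
by split=> U; rewrite /adm_at /= AE.
Qed.

Lemma AX_nat_iso : nat_iso (A \oF X) (id_functor (op_cat BrwMS_P)).
Proof.
(* Components live in the opposite category, so the map of semilattices from [a] to [phi a] already
   points towards the identity functor. *)
have ex (B : brwMS) : exists p : @hom BrwMS_P B (A_obj A_wf_holds (X_obj
  X_wf_holds B)),
    (forall a, val (sval p a) = @phi _ B a) /\ isomorphism p.
  have [p [piso pE]] := @space_repr_adm (X_obj X_wf_holds B) _ _ _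
    (brwMSP B) (optimal_space_repr B).
  have [g [gE gI]] := @order_iso_brwMS B (A_obj A_wf_holds (X_obj X_wf_holds B))
    p piso.
  by exists g; rewrite gE.
pose p (B : brwMS) := cid (ex B).
exists (fun B => sval (p B)); split=> [B C h|B]; last first.
  by rewrite /p; case: cid => g /= [_ [g' [gK g'K]]]; exists g'.
have pE (D : brwMS) a : val (sval (sval (p D)) a) = @phi _ D a.
  by rewrite /p; case: cid => g /= [].
apply: sval_inj; apply/funext => a; apply: val_inj.
apply: etrans (pE _ _) _; apply: etrans _ (esym (AP _ _)).
rewrite pE; apply/seteqP; have hE := XP h.
by split=> x; rewrite /phi /= hE.
Qed.

End AX_XA.

(** * Admissible closed upsets *)

Section closed_upsets.
Variable X : pges.

Let AX : porderType _ := adm_clopen_upsets (pges_core X).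
Let VX : porderType _ := ((adm_closed_upsets (pges_core X) : Type)^d)%O.

Definition adm_above (C : VX) : set AX :=
  [set U | val (C : adm_closed_upsets (pges_core X)) `<=` val U].

(** [x] lies below a core point [p] outside [C]; admissible clopen upsets avoiding [p] cover the
    compact set [C], and directedness merges a finite subcover into one. *)
Lemma adm_closed_separation (C : set X) x :
  adm_closed_upsets (pges_core X) C -> ~ C x ->
  exists U : AX, C `<=` val U /\ ~ val U x.
Proof.
move=> [Ca Cc Cup] nCx; have [p [Xp xp nCp]] := adm_core_avoiding Ca nCx.
have [| |S [Sfin Sp CS]] := @compact_subcover X (set X) C
    (adm_avoiding (pges_core X) p) id (@pges_compact X) Cc.
- by move=> U [[_ []]].
- move=> y Cy; apply: contrapT => ny; apply: nCp; apply: (Cup y) => //.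
  by apply/pges_leP => U UU Uy; apply: contrapT => nUp; apply: ny; exists U.
have [U [UU nUp] SU] := pges_avoid Xp Sfin Sp; exists (set_type_elt UU); split.
  by move=> y /CS [V SV Vy]; exact: SU SV _ Vy.
by move=> Ux; apply: nUp; have [_ _ Uup] := UU; exact: Uup xp.
Qed.

Lemma adm_above_bigcap (C : VX) :
  \bigcap_(U in adm_above C) val U = val (C : adm_closed_upsets (pges_core X)).
Proof.
apply/seteqP; split=> x; last by move=> Cx U; apply.
move=> CU; apply: contrapT => nCx.
have [U [CU' nUx]] := adm_closed_separation (set_valP (C : adm_closed_upsets _))
  nCx.
exact/nUx/CU.
Qed.

Lemma adm_above_repr : filter_repr adm_above.
Proof.
split.
- move=> C D; change (val (D : adm_closed_upsets (pges_core X)) <=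
    val (C : adm_closed_upsets (pges_core X)) <-> adm_above C `<=` adm_above D).
  rewrite subsetEset; split=> [DC U CU|CD]; first exact: subset_trans CU.
  by rewrite -!adm_above_bigcap => x DU U /CD; exact: DU.
- move=> C; have -> : adm_above C =
      \bigcap_(x in val (C : adm_closed_upsets (pges_core X))) adm_at x.
    by apply/seteqP; split=> U CU x; exact: CU.
  by apply: filter_bigcap => [|x _]; [exact: adm_brouwerian|exact:
    adm_at_filter].
- move=> F Ff; pose C : set X := \bigcap_(U in F) val U.
  have CC : adm_closed_upsets (pges_core X) C.
    split.
    + move=> x /existsNP [U /not_implyP [FU nUx]].
      have [Ua _ _] := set_valP U; have [y [Xy xy nUy]] :=
        adm_core_avoiding Ua nUx.
      by exists y => //; split=> // Cy; apply: nUy; exact: Cy.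
    + by apply: closed_bigI => U _; have [_ []] := set_valP U.
    + by move=> x y Cx xy U FU; have [_ _ Uup] := set_valP U;
        exact: Uup (Cx U FU) xy.
  exists (set_type_elt CC); apply/seteqP; split=> U; last by move=> FU x; apply.
  (* Compactness of the complement of [U] finds finitely many members of [F] whose intersection is
     inside [U]; their meet is in [F] and below [U]. *)
  rewrite /adm_above /= => CU.
  have [_ [Uo Uc] _] := set_valP U.
  have [| |S [Sfin SF US]] := @compact_subcover X AX (~` val U) F
      (fun V => ~` val V) (@pges_compact X) (open_closedC Uo).
  + by move=> V _; apply: closed_openC; have [_ []] := set_valP V.
  + move=> x nUx; apply: contrapT => nV; apply: nUx; apply: CU => V FV.
    by apply: contrapT => nVx; apply: nV; exists V.
  have [t St] := (adm_brouwerian X).1 S Sfin.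
  apply: (Ff.1 t); first exact: Ff.2 Sfin SF St.
  apply/adm_le => x tx; apply: contrapT => /US [V SV]; apply.
  by have /infimumsP /(_ t) [/(_ (lexx t) V SV) /adm_le tV _] := St; exact: tV.
Qed.

End closed_upsets.

Lemma V_wf_holds : V_wf.
Proof.
move=> X; exact: filter_repr_is_brouwerian_frame (adm_brouwerian X)
  (@adm_above_repr X).
Qed.

(** * The triangle *)

Section triangle.
Variables (F : functor BrwMS_P BrwFrm (F_obj F_wf_holds)).
Variables (K : functor BrwFrm BrwMS_P K_obj).
Variables (X : functor (op_cat BrwMS_P) PGES_P (X_obj X_wf_holds)).
Variables (A : functor PGES_P (op_cat BrwMS_P) (A_obj A_wf_holds)).
Hypotheses (FP : F_spec F) (KP : K_spec K) (XP : X_spec X) (AP : A_spec A).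

(** The transported functor sends [y] to the [z] whose compact lower bounds are the compact [k] with
    [alpha k <= y]; algebraicity extends this equivalence to all [a], which is the adjunction. *)
Lemma Y_functor_ex :
  exists Y : functor (op_cat BrwFrm) PGES_P (Y_obj Y_wf_holds),
    Y_spec Y /\ nat_iso (X \oF op_functor K) Y.
Proof.
have Yr (L : brwFrm) : space_repr (pges_core (Y_obj Y_wf_holds L))
    (fun x : Y_obj Y_wf_holds L => compacts_below (val (x : pseudoprime_space
      L))).
  by have [] := pseudoprime_space_spectral (brwFrmP L) (@top_element_max L).
pose p (L : brwFrm) := cid (@space_repr_iso (X_obj X_wf_holds (K_obj L))
  (Y_obj Y_wf_holds L) (K_obj L) _ _ (optimal_space_repr (K_obj L)) (Yr L)).
pose q (L : brwFrm) := cid (svalP (p L)).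
have pqE (L : brwFrm) : [/\
    forall x, compacts_below (val (sval (sval (p L)) x : pseudoprime_space L)) =
      val (x : optimal_space (K_obj L)),
    forall y, val (sval (sval (q L)) y : optimal_space (K_obj L)) =
      compacts_below (val (y : pseudoprime_space L)),
    @comp PGES_P _ _ _ (sval (q L)) (sval (p L)) = idc _ &
    @comp PGES_P _ _ _ (sval (p L)) (sval (q L)) = idc _].
  exact: svalP (q L).
have qK (L : op_cat BrwFrm) : @comp PGES_P _ _ _ (sval (q L)) (sval (p L)) = idc
  _.
  by case: (pqE L).
have pK (L : op_cat BrwFrm) : @comp PGES_P _ _ _ (sval (p L)) (sval (q L)) = idc
  _.
  by case: (pqE L).
have [Y XKY YE] := nat_iso_transport (X \oF op_functor K) qK pK.
exists Y; split=> // L M alpha y a; rewrite YE.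
have [pE _ _ _] := pqE L; have [_ qE _ _] := pqE M.
set z := (X in _ = (a <= X)).
have zE : compacts_below z =
    sval (fmap K alpha) @^-1` compacts_below (val (y : pseudoprime_space M)).
  pose w : optimal_space (K_obj L) :=
    sval (@fmap _ _ _ X (K_obj M) (K_obj L) (fmap K alpha)) (sval (sval (q M))
      y).
  transitivity (val w); first exact (pE w).
  rewrite -qE; exact (XP (fmap K alpha) (sval (sval (q M)) y)).
have Ka := KP alpha.
have kz k : compacts_below z k <->
    sval alpha (val (k : @compacts _ L)) <= val (y : pseudoprime_space M).
  by rewrite zE -Ka.
apply/idP/idP => [ay|/(algebraic_le (brwFrmP L)) az].
  apply/(algebraic_le (brwFrmP L)) => k ka; apply/kz.
  by apply: le_trans ay; apply: brwFrm_hom_le ka; exact: svalP.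
apply: brwFrm_hom_compact_le; first exact: svalP.
by move=> k ka; exact/kz/az.
Qed.

(** The transported functor sends [C] to the intersection of the filter generated by the preimages
    of the admissible clopen upsets including [C]; as these upsets intersect in [C], the result is
    the preimage of [C]. *)
Lemma V_functor_ex :
  exists V : functor PGES_P (op_cat BrwFrm) (V_obj V_wf_holds),
    V_spec V /\ nat_iso (op_functor F \oF A) V.
Proof.
have ex (Z : pges) : exists (p : brwFrm_hom (V_obj V_wf_holds Z)
      (F_obj F_wf_holds (A_obj A_wf_holds Z))) (q : brwFrm_hom
      (F_obj F_wf_holds (A_obj A_wf_holds Z)) (V_obj V_wf_holds Z)),
    [/\ forall C, val (sval p C) = adm_above C,
        forall H, adm_above (sval q H) = val H,
        @comp BrwFrm _ _ _ q p = idc _ & @comp BrwFrm _ _ _ p q = idc _].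
  have [p0 [piso p0E]] := filter_repr_order_iso (@adm_above_repr Z)
    (filters_repr _).
  have [p [pE [q [qp pq]]]] := @order_iso_brwFrm (V_obj V_wf_holds Z)
    (F_obj F_wf_holds (A_obj A_wf_holds Z)) p0 piso.
  exists p, q; split=> [C|H| |]; [by rewrite pE p0E|rewrite -p0E -pE|exact:
    qp|exact: pq].
  congr val; exact: (congr1 (fun f => sval f H) pq).
pose p (Z : pges) := cid (ex Z).
pose q (Z : pges) := cid (svalP (p Z)).
have pqE (Z : pges) : [/\ forall C, val (sval (sval (p Z)) C) = adm_above C,
        forall H, adm_above (sval (sval (q Z)) H) = val H,
        @comp BrwFrm _ _ _ (sval (q Z)) (sval (p Z)) = idc _ &
        @comp BrwFrm _ _ _ (sval (p Z)) (sval (q Z)) = idc _].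
  exact: svalP (q Z).
have pqK (Z : PGES_P) : @comp BrwFrm _ _ _ (sval (p Z)) (sval (q Z)) = idc _.
  by case: (pqE Z).
have qpK (Z : PGES_P) : @comp BrwFrm _ _ _ (sval (q Z)) (sval (p Z)) = idc _.
  by case: (pqE Z).
have [V FAV VE] := @nat_iso_transport PGES_P (op_cat BrwFrm) _ (V_obj
  V_wf_holds)
  (op_functor F \oF A) (fun Z => sval (p Z)) (fun Z => sval (q Z)) pqK qpK.
exists V; split=> // Z W f C; rewrite VE.
have [_ qE _ _] := pqE Z; have [pE _ _ _] := pqE W.
set D := (X in val X = _).
have DE : adm_above D = upclosure (sval (fmap A f) @` adm_above C).
  pose H : @filters _ (adm_clopen_upsets (pges_core Z)) :=
    sval (fmap F (fmap A f)) (sval (sval (p W)) C).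
  transitivity (val H); first exact (qE H).
  rewrite -pE; exact (FP (fmap A f) (sval (sval (p W)) C)).
apply: etrans (esym (adm_above_bigcap D)) _; rewrite DE.
rewrite -[in RHS](adm_above_bigcap (X := W)); have AE := AP f.
apply/seteqP; split=> x.
  move=> xD U CU; have := xD (sval (fmap A f) U).
  rewrite AE; apply; exists (sval (fmap A f) U) => //; by exists U.
move=> xC U [_ [T CT <-] /adm_le TU]; apply: TU.
by rewrite AE; exact: xC.
Qed.

End triangle.

Theorem theorem4p22 :
  exists (wF : F_wf) (wX : X_wf) (wA : A_wf) (wY : Y_wf) (wV : V_wf)
    (F : functor BrwMS_P BrwFrm (F_obj wF))
    (K : functor BrwFrm BrwMS_P K_obj)
    (X : functor (op_cat BrwMS_P) PGES_P (X_obj wX))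
    (A : functor PGES_P (op_cat BrwMS_P) (A_obj wA))
    (Y : functor (op_cat BrwFrm) PGES_P (Y_obj wY))
    (V : functor PGES_P (op_cat BrwFrm) (V_obj wV)),
    [/\ F_spec F, K_spec K & X_spec X] /\
    [/\ A_spec A, Y_spec Y & V_spec V] /\
    equivalence_of_categories F K /\
    equivalence_of_categories Y V /\
    [/\ nat_iso (Y \oF op_functor F) X, nat_iso (V \oF X) (op_functor F)
      & nat_iso (X \oF op_functor K) Y] /\
    [/\ nat_iso (op_functor K \oF V) A, nat_iso (A \oF Y) (op_functor K)
      & nat_iso (op_functor F \oF A) V].
Proof.
have [F FP] := F_functor_ex; have [K KP] := K_functor_ex.
have [X XP] := X_functor_ex; have [A AP] := A_functor_ex.
have [Y [YP XKY]] := Y_functor_ex KP XP.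
have [V [VP FAV]] := V_functor_ex FP AP.
have YXK := nat_iso_sym XKY; have VFA := nat_iso_sym FAV.
have KF := KF_nat_iso FP KP; have FK := FK_nat_iso FP KP.
have AX := AX_nat_iso XP AP; have XA := XA_nat_iso XP AP.
have KFop := nat_iso_op KF; have FKop := nat_iso_op FK.
have VX : nat_iso (V \oF X) (op_functor F).
  apply: nat_iso_trans (nat_iso_whiskerr X VFA) _.
  exact (nat_iso_whiskerl (op_functor F) AX).
have YF : nat_iso (Y \oF op_functor F) X.
  apply: nat_iso_trans (nat_iso_whiskerr (op_functor F) YXK) _.
  exact (nat_iso_whiskerl X KFop).
(* [V] after [Y] becomes [V] after [X] after [K], then [F] after [K], in the opposite category. *)
have VY : nat_iso (V \oF Y) (id_functor (op_cat BrwFrm)).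
  apply: nat_iso_trans (nat_iso_whiskerl V YXK) _.
  apply: nat_iso_trans FKop.
  exact (nat_iso_whiskerr (op_functor K) VX).
(* [Y] after [V] becomes [Y] after [F] after [A], then [X] after [A]. *)
have YV : nat_iso (Y \oF V) (id_functor PGES_P).
  apply: nat_iso_trans (nat_iso_whiskerl Y VFA) _.
  apply: nat_iso_trans XA.
  exact (nat_iso_whiskerr A YF).
exists F_wf_holds, X_wf_holds, A_wf_holds, Y_wf_holds, V_wf_holds.
exists F, K, X, A, Y, V; split=> //; split=> //; split=> //; split=> //.
split; split=> //.
  apply: nat_iso_trans (nat_iso_whiskerl (op_functor K) VFA) _.
  exact (nat_iso_whiskerr A KFop).
apply: nat_iso_trans (nat_iso_whiskerl A YXK) _.
exact (nat_iso_whiskerr (op_functor K) AX).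
Qed.
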